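(* Let $U \subset \mathbb{R}^3$ be an open set. The space of all Beltrami fields on $U$ with constant proportionality factor (that is, of all vector fields $\mathbf{u}$ on $U$ such that $\operatorname{curl}\mathbf{u} = c\,\mathbf{u}$ and $\operatorname{div}\mathbf{u} = 0$ for some constant $c \in \mathbb{R}$, where $c$ is not prescribed and is allowed to vary with $\mathbf{u}$) is locally parametrized by 2 functions of 2 variables.
   Context: Definition. A Beltrami field on an open set $U \subset \mathbb{R}^3$ is a vector field $\mathbf{u}$ on $U$ satisfying $\operatorname{curl}\mathbf{u} = f\mathbf{u}$, $\operatorname{div}\mathbf{u} = 0$ for some smooth function $f:U\to\mathbb{R}$, called the proportionality factor. Here $f$ is a constant function (the value $0$ is allowed). Standing conventions. Only locally defined, real analytic functions $f$ and Beltrami fields $\mathbf{u}$ are considered. All statements are local: $U$ may be replaced by a smaller open set whenever necessary. Meaning of ''locally parametrized by $k$ functions of $n$ variables''. This is the usual function count of the Cauchy–Kowalevski and Cartan–Kähler theorems: near a generic point, real analytic local solutions of the PDE system under consideration are in correspondence with freely chosen initial data consisting of $k$ arbitrary real analytic functions of $n$ variables, up to arbitrary functions of fewer than $n$ variables and constants, which are not counted (in particular the real parameter $c$ is not counted). Equivalently, the associated involutive exterior differential system (after prolongation if needed) has last nonzero Cartan character $s_n = k$. *)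

(* Defs.v *)
From HB Require Import structures.
From mathcomp Require Import all_boot all_order all_algebra finmap.
From mathcomp Require Import all_classical all_reals all_analysis.
From mathcomp.analysis.showcase Require Import summability.
Set Implicit Arguments.
Unset Strict Implicit.
Unset Printing Implicit Defensive.
Import Order.TTheory GRing.Theory Num.Theory.
Import numFieldNormedType.Exports.
Local Open Scope classical_set_scope.
Local Open Scope ring_scope.

(* Convergence along [totally] (the filter of finite sets of multi-indices) is
   unconditional, i.e. absolute, convergence of the multiple power series. *)
Definition analytic_at (R : realType) (m : nat) (f : 'rV[R]_m -> R)
    (p : 'rV[R]_m) : Prop :=
  exists a : {ffun 'I_m -> nat} -> R, \forall x \near p,
    partial_sum
      (fun al : {ffun 'I_m -> nat} =>
         a al * \prod_(i < m) ((x : 'rV[R]_m) 0 i - p 0 i) ^+ al i) @ totally --> f x.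

Definition analytic_on (R : realType) (m : nat) (V : set 'rV[R]_m)
    (f : 'rV[R]_m -> R) : Prop :=
  forall p, V p -> analytic_at f p.

Definition pderiv (R : realType) (m : nat) (i : 'I_m) (f : 'rV[R]_m -> R)
    (x : 'rV[R]_m) : R :=
  'D_(delta_mx 0 i) f x.

(* Indices in ['I_3] are added modulo 3, so the j-th entry is
   d_(j+1) u_(j+2) - d_(j+2) u_(j+1). *)
Definition curl (R : realType) (u : 'rV[R]_3 -> 'rV[R]_3) (x : 'rV[R]_3) :
    'rV[R]_3 :=
  \row_(j < 3) (pderiv (j + 1) (fun y => u y 0 (j + 2)) x
              - pderiv (j + 2) (fun y => u y 0 (j + 1)) x).

Definition div (R : realType) (u : 'rV[R]_3 -> 'rV[R]_3) (x : 'rV[R]_3) : R :=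
  \sum_(i < 3) pderiv i (fun y => u y 0 i) x.

(* [u] is a (real analytic) Beltrami field on [V] with proportionality
   factor [f]; only the values of [f] and [u] on [V] matter. *)
Definition beltrami (R : realType) (V : set 'rV[R]_3) (f : 'rV[R]_3 -> R)
    (u : 'rV[R]_3 -> 'rV[R]_3) : Prop :=
  [/\ analytic_on V f,
      forall j, analytic_on V (fun x => u x 0 j)
    & forall x, V x -> curl u x = f x *: u x /\ div u x = 0].

Definition beltrami_constant_factor (R : realType) (V : set 'rV[R]_3)
    (u : 'rV[R]_3 -> 'rV[R]_3) : Prop :=
  exists c : R, beltrami V (fun=> c) u.

(* One initial datum for fields R^m -> R^N, relative to a frame of R^m: the
   derivative of the component [datum_comp], successively along the frame
   vectors listed in [datum_order], is prescribed on the span of the first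
   [datum_dim] frame vectors; it is a function of [datum_dim] variables. *)
Record datum (m N : nat) := Datum {
  datum_dim : 'I_m.+1;
  datum_order : seq 'I_m;
  datum_comp : 'I_N }.

Definition frame_deriv (R : realType) (m : nat) (A : 'M[R]_m) (l : seq 'I_m)
    (f : 'rV[R]_m -> R) : 'rV[R]_m -> R :=
  foldr (fun i h x => 'D_(row i A) h x) f l.

(* [y *m pid_mx d *m A] is y_0 *: row 0 A + ... + y_(d-1) *: row (d-1) A. *)
Definition has_data (R : realType) (m N d : nat) (p : 'rV[R]_m) (A : 'M[R]_m)
    (s : 'I_d -> datum m N) (g : forall i, 'rV[R]_(datum_dim (s i)) -> R)
    (u : 'rV[R]_m -> 'rV[R]_N) : Prop :=
  forall i, \forall y \near (0 : 'rV[R]_(datum_dim (s i))),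
    frame_deriv A (datum_order (s i)) (fun x => u x 0 (datum_comp (s i)))
      (p + y *m pid_mx (datum_dim (s i)) *m A) = g i y.

(* [S V u] reads "[u] is a solution on the open set [V]". *)
Definition local_solution (R : realType) (m N : nat) (U : set 'rV[R]_m)
    (S : set 'rV[R]_m -> ('rV[R]_m -> 'rV[R]_N) -> Prop) (p : 'rV[R]_m)
    (u : 'rV[R]_m -> 'rV[R]_N) : Prop :=
  exists V : set 'rV[R]_m, [/\ open V, V p, V `<=` U & S V u].

(* The function count of Cauchy-Kowalevski and Cartan-Kaehler: near every point
   [p] of a dense open subset of [U], taking initial data along a flag through
   [p] maps the germs of solutions at [p] onto all tuples of germs of real
   analytic functions, of which exactly [k] depend on [n] variables and the
   others on fewer.  Since constants are not counted, the germs of solutions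
   with given data need not be unique: they may form a real analytic family
   depending on [q] real constants [theta] (with [q] independent of the data;
   [theta] itself need not be determined by the solution).  All of this refers
   to actual germs and to derivatives restricted to linear subspaces: a mere
   bijection between solutions and tuples of functions would carry no
   information, as the two sets have the same cardinality. *)
Definition locally_parametrized (R : realType) (m N : nat) (k n : nat)
    (U : set 'rV[R]_m)
    (S : set 'rV[R]_m -> ('rV[R]_m -> 'rV[R]_N) -> Prop) : Prop :=
  exists G : set 'rV[R]_m,
  [/\ open G, G `<=` U, U `<=` closure G
    & forall p, G p ->
      exists (A : 'M[R]_m) (d : nat) (s : 'I_d -> datum m N) (q : nat),
      [/\ A \in unitmx,
          forall i, (datum_dim (s i) <= n)%N,
          #|[set i | datum_dim (s i) == n :> nat]%SET| = k,
          forall u, local_solution U S p u ->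
            exists2 g : forall i, 'rV[R]_(datum_dim (s i)) -> R,
              forall i, analytic_at (g i) 0 & has_data p A g u
        & forall g : forall i, 'rV[R]_(datum_dim (s i)) -> R,
            (forall i, analytic_at (g i) 0) ->
            exists Phi : 'rV[R]_q -> 'rV[R]_m -> 'rV[R]_N,
            [/\ forall theta, local_solution U S p (Phi theta)
                              /\ has_data p A g (Phi theta),
                forall theta j, analytic_at
                  (fun z : 'rV[R]_(q + m) => Phi (lsubmx z) (rsubmx z) 0 j)
                  (row_mx theta p)
              & forall u, local_solution U S p u -> has_data p A g u ->
                  exists theta, \forall x \near p, u x = Phi theta x]]].

(* Main.v *)
From HB Require Import structures.
Require Import Defs.
From mathcomp Require Import all_boot all_order all_algebra finmap.
From mathcomp Require Import all_classical all_reals all_analysis.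
From mathcomp.analysis.showcase Require Import summability.
From mathcomp Require Import ring lra zify.
Import Order.TTheory GRing.Theory Num.Theory.
Import numFieldNormedType.Exports.

Set Implicit Arguments.
Unset Strict Implicit.
Unset Printing Implicit Defensive.
Local Open Scope classical_set_scope.
Local Open Scope ring_scope.

(** Write a solution as u = (u_0, u_1, u_2) and let c be its proportionality
    factor.  Solved for the derivatives in the last coordinate, the equations
    curl u = c u and div u = 0 read

      d_2 u_0 = d_0 u_2 + c u_1,   d_2 u_1 = d_1 u_2 - c u_0,
      d_2 u_2 = - d_0 u_0 - d_1 u_1,

    together with the constraint d_1 u_0 = d_0 u_1 - c u_2, which holds
    everywhere as soon as it holds on the plane spanned by the first two
    coordinate axes through the base point.  Read on that plane, the
    constraint is an evolution equation for u_0 in the second coordinate.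
    Hence, for every c, zero included, a solution is determined by u_1 and u_2
    on the plane (two functions of two variables) and by u_0 on the first axis
    (one function of one variable), and these data are arbitrary.  The only
    remaining freedom is the constant c, so the solutions with given data form
    a family with one parameter.

    Existence: the equations determine the derivatives of the solution
    recursively ([jet]), as polynomials in c.  With c as a fourth variable,
    the coefficient of a monomial of total degree N in the three space
    variables is O(Q ^ N) ([jet_coef_bound]) and its degree in c is at most N
    ([jet_support]), so the power series in (c, x) converges for c in any
    bounded interval provided x is close to the base point
    ([jet_coef_dominated]).  It solves the equations because
    its coefficients do ([jet_curl], [jet_div]).

    Uniqueness: the coefficients of a solution satisfy the same recursion,
    hence are determined by c and the data ([beltrami_coef_unique]).

    The theory of multiple power series needed for this rests on one result,
    the re-expansion of a power series about another point of its polydisc of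
    convergence ([taylor]), which yields the analyticity of the sum, its
    partial derivatives ([expands_pderiv]) and the uniqueness of the
    coefficients ([expands_unique]). *)

#[local] Existing Instance totally_filter.

(** * Unconditional summation of families of real numbers *)

Section Summation.
Variable R : realType.

(** The family [a] is unconditionally summable with sum [s]. *)
Definition has_sum (I : choiceType) (a : I -> R) (s : R) : Prop :=
  partial_sum a @ totally --> s.

(** Absolute summability, as a uniform bound on the finite partial sums. *)
Definition abs_summable (I : choiceType) (a : I -> R) : Prop :=
  exists M : R, forall A : {fset I}, \sum_(i <- A) `|a i| <= M.

Lemma partial_sumE (I : choiceType) (a : I -> R) (A : {fset I}) :
  partial_sum a A = \sum_(i <- A) a i.
Proof. by rewrite /partial_sum big_seq_fsetE. Qed.

Lemma has_sumP (I : choiceType) (a : I -> R) (s : R) :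
  has_sum a s <-> forall e : R, 0 < e -> exists A : {fset I},
    forall B : {fset I}, (A `<=` B)%fset -> `|s - \sum_(i <- B) a i| < e.
Proof.
split=> [/cvgrPdist_lt H e e0|H].
  have [A _ HA] := H e e0; exists A => B AB.
  by rewrite -partial_sumE; exact: HA.
apply/cvgrPdist_lt => e e0; have [A HA] := H e e0.
by exists A => // B AB; rewrite partial_sumE; exact: HA.
Qed.

Lemma has_sum_unique (I : choiceType) (a : I -> R) (s t : R) :
  has_sum a s -> has_sum a t -> s = t.
Proof. by move=> Hs Ht; exact: (cvg_unique _ Hs Ht). Qed.

Lemma has_sum_eq (I : choiceType) (a b : I -> R) (s t : R) :
  a =1 b -> s = t -> has_sum a s -> has_sum b t.
Proof. by move=> /funext -> ->. Qed.

Lemma has_sumD (I : choiceType) (a b : I -> R) (s t : R) :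
  has_sum a s -> has_sum b t -> has_sum (fun i => a i + b i) (s + t).
Proof.
move=> Ha Hb; rewrite /has_sum.
have -> : partial_sum (fun i => a i + b i) = partial_sum a \+ partial_sum b.
  by apply/funext => A; rewrite /= !partial_sumE big_split.
exact: cvgD.
Qed.

Lemma has_sumZ (I : choiceType) (a : I -> R) (s k : R) :
  has_sum a s -> has_sum (fun i => k * a i) (k * s).
Proof.
move=> Ha; rewrite /has_sum.
have -> : partial_sum (fun i => k * a i) = (fun A => k * partial_sum a A).
  by apply/funext => A; rewrite !partial_sumE big_distrr.
exact: cvgMr.
Qed.

Lemma has_sumB (I : choiceType) (a b : I -> R) (s t : R) :
  has_sum a s -> has_sum b t -> has_sum (fun i => a i - b i) (s - t).
Proof.
move=> Ha /(has_sumZ (k := -1)) Hb.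
by apply: has_sum_eq (has_sumD Ha Hb) => [i|]; rewrite mulN1r.
Qed.

Lemma has_sum_finite (I : choiceType) (a : I -> R) (A : {fset I}) :
  (forall i, i \notin A -> a i = 0) -> has_sum a (\sum_(i <- A) a i).
Proof.
move=> HA; apply/has_sumP => e e0; exists A => B AB.
rewrite (big_fset_incl _ AB) ?subrr ?normr0// => i _; exact: HA.
Qed.

Lemma has_sum0 (I : choiceType) : has_sum (fun _ : I => 0) 0.
Proof.
apply: has_sum_eq (@has_sum_finite _ (fun _ : I => 0) fset0 _) => //.
by rewrite big_seq_fset0.
Qed.

Lemma has_sum_le (I : choiceType) (a : I -> R) (s M : R) (A0 : {fset I}) :
  has_sum a s ->
  (forall A : {fset I}, (A0 `<=` A)%fset -> `|\sum_(i <- A) a i| <= M) ->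
  `|s| <= M.
Proof.
move=> /has_sumP H HM; apply/ler_addgt0Pr => e e0; have [A HA] := H e e0.
have /HA/ltW : (A `<=` A `|` A0)%fset by exact: fsubsetUl.
have /HM : (A0 `<=` A `|` A0)%fset by exact: fsubsetUr.
move=> h1 h2; rewrite -(subrK (\sum_(i <- (A `|` A0)%fset) a i) s).
by rewrite (le_trans (ler_normD _ _))// addrC lerD.
Qed.

(** The terms of a summable family are bounded. *)
Lemma has_sum_bounded (I : choiceType) (a : I -> R) (s : R) :
  has_sum a s -> exists M, forall i, `|a i| <= M.
Proof.
move=> /has_sumP /(_ 1 ltr01)[A HA].
exists (2 + \sum_(i <- A) `|a i|) => i.
have s0 : 0 <= \sum_(i <- A) `|a i| by exact: sumr_ge0.
have [iA|iA] := boolP (i \in A).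
  rewrite (big_fsetD1 i)//= addrCA lerDl addr_ge0//; exact: sumr_ge0.
have h1 := HA A (fsubset_refl _).
have h2 := HA (i |` A)%fset (fsubsetUr _ _).
rewrite big_fsetU1//= in h2.
suff : `|a i| <= 2 by move=> h; rewrite (le_trans h)// lerDl.
set t := \sum_(i <- A) a i in h1 h2.
have -> : a i = (s - t) - (s - (a i + t)) by ring.
rewrite (le_trans (ler_normB _ _))//; lra.
Qed.

Lemma big_fset_subset_le (I : choiceType) (a : I -> R) (A B : {fset I}) :
  (forall i, 0 <= a i) -> (A `<=` B)%fset ->
  \sum_(i <- A) a i <= \sum_(i <- B) a i.
Proof.
move=> a0 AB.
have -> : \sum_(i <- A) a i = \sum_(i <- A) (if i \in A then a i else 0).
  by rewrite big_seq [RHS]big_seq; apply: eq_bigr => i ->.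
rewrite (big_fset_incl _ AB) => [|i _ /negbTE ->//].
by apply: ler_sum => i _; case: ifP.
Qed.

Lemma nonneg_bounded_has_sum (I : choiceType) (a : I -> R) (M : R) :
  (forall i, 0 <= a i) -> (forall A : {fset I}, \sum_(i <- A) a i <= M) ->
  exists s, has_sum a s.
Proof.
move=> a0 HM; pose E := [set \sum_(i <- A) a i | A in [set: {fset I}]].
have hE : has_sup E.
  split; first by exists (\sum_(i <- fset0) a i), fset0.
  by exists M => _ [A _ <-].
exists (sup E); apply/has_sumP => e e0.
have [_ [A _ <-] hA] := sup_adherent e0 hE; exists A => B AB.
have h1 := big_fset_subset_le a0 AB.
have h2 : \sum_(i <- B) a i <= sup E by apply: ub_le_sup; [case: hE|exists B].
rewrite ger0_norm; lra.
Qed.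

Lemma abs_summable_has_sum (I : choiceType) (a : I -> R) :
  abs_summable a -> exists s, has_sum a s.
Proof.
move=> [M HM].
have [s Hs] : exists s, has_sum (fun i => `|a i|) s.
  exact: (@nonneg_bounded_has_sum _ _ M).
have [t Ht] : exists t, has_sum (fun i => a i + `|a i|) t.
  apply: (@nonneg_bounded_has_sum _ _ (M + M)) => [i|A].
    by have := ler_norm (- a i); rewrite normrN; lra.
  rewrite big_split/= lerD//; apply: le_trans (HM A).
  by apply: ler_sum => i _; exact: ler_norm.
exists (t - s); apply: has_sum_eq (has_sumB Ht Hs) => // i.
by rewrite addrK.
Qed.

Lemma abs_summable_le (I : choiceType) (a b : I -> R) :
  (forall i, `|a i| <= b i) -> abs_summable b -> abs_summable a.
Proof.
move=> ab [M HM]; exists M => A; apply: le_trans (HM A).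
by apply: ler_sum => i _; apply: (le_trans (ab i)); exact: ler_norm.
Qed.

Lemma abs_summableZ (I : choiceType) (a : I -> R) (k : R) :
  abs_summable a -> abs_summable (fun i => k * a i).
Proof.
move=> [M HM]; exists (`|k| * M) => A.
under eq_bigr do rewrite normrM.
by rewrite -big_distrr/= ler_wpM2l.
Qed.

(** Inserting zero terms and relabelling the indices affects neither
    summability nor the sum. *)
Lemma has_sum_reindex (I J : choiceType) (f : J -> I) (a : I -> R) (s : R) :
  injective f -> (forall i, a i != 0 -> exists j, f j = i) ->
  has_sum a s <-> has_sum (a \o f) s.
Proof.
move=> finj fa.
have sumf (B : {fset J}) :
    \sum_(i <- [fset f j | j in B]%fset) a i = \sum_(j <- B) a (f j).
  by rewrite big_imfset//= => x y _ _; exact: finj.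
(* A partial inverse of [f] provides preimages of finite sets. *)
have [g gP] : exists g : I -> option J, forall i j, g i = Some j <-> f j = i.
  have /choice[g gP] : forall i, exists o, forall j, o = Some j <-> f j = i.
    move=> i; have [[j fj]|nj] := pselect (exists j, f j = i).
      by exists (Some j) => j'; split=> [[<-]//|]; rewrite -fj => /finj ->.
    by exists None => j; split=> // fj; case: nj; exists j.
  by exists g.
have [P PP] : exists P : {fset I} -> {fset J},
    forall A j, (j \in P A) = (f j \in A).
  exists (fun A => [fset j in pmap g (enum_fset A)]%fset) => A j.
  rewrite !inE mem_pmap; apply/mapP/idP => [[i iA /esym/gP ->]//|fjA].
  by exists (f j) => //; symmetry; apply/gP.
split=> /has_sumP H; apply/has_sumP => e e0; have [A HA] := H e e0.
  exists (P A) => B /fsubsetP PB.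
  rewrite -sumf; have := HA (A `|` [fset f j | j in B])%fset (fsubsetUl _ _).
  rewrite -(big_fset_incl _ (fsubsetUr A _))// => i iA /imfsetP/= iB.
  apply/eqP/negPn/negP => /fa[j fj].
  move: iA; rewrite in_fsetU => /orP[iA|/imfsetP/iB//].
  by apply: iB; exists j => //; apply: PB; rewrite PP fj.
exists [fset f j | j in A]%fset => B /fsubsetP fAB.
have := HA (P B); rewrite -sumf => HPB.
have {HPB} : `|s - \sum_(i <- [fset f j | j in P B]%fset) a i| < e.
  apply: HPB; apply/fsubsetP => j jA; rewrite PP.
  by apply: fAB; apply/imfsetP; exists j.
have PBB : ([fset f j | j in P B] `<=` B)%fset.
  by apply/fsubsetP => _ /imfsetP[j/= + ->]; rewrite PP.
rewrite (big_fset_incl _ PBB)// => i iB /imfsetP/= iP.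
apply/eqP/negPn/negP => /fa[j fj]; apply: iP; exists j => //.
by rewrite PP fj.
Qed.

Lemma sum_fsetM (I J : choiceType) (F : I * J -> R)
    (A : {fset I}) (B : {fset J}) :
  \sum_(p <- (A `*` B)%fset) F p = \sum_(i <- A) \sum_(j <- B) F (i, j).
Proof.
rewrite -(big_allpairs (F := F)); apply: perm_big; apply: uniq_perm.
- exact: fset_uniq.
- by rewrite allpairs_uniq// => -[? ?] [? ?] _ _ [-> ->].
- move=> [i j]; rewrite in_fsetM/=.
  apply/andP/allpairsP => [[iA jB]|[[i' j'] [/= iA jB [-> ->]]]//].
  by exists (i, j).
Qed.

Lemma has_sum_sum (I J : choiceType) (F : I -> J -> R) (t : I -> R)
    (r : seq I) :
  (forall i, has_sum (F i) (t i)) ->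
  has_sum (fun j => \sum_(i <- r) F i j) (\sum_(i <- r) t i).
Proof.
move=> H; elim: r => [|i r IH].
  by apply: has_sum_eq (has_sum0 J) => [j|]; rewrite big_nil.
by apply: has_sum_eq (has_sumD (H i) IH) => [j|]; rewrite big_cons.
Qed.

(** Fubini: a double sum may be computed by summing over the second index
    first. *)
Lemma has_sum_fubini (I J : choiceType) (F : I * J -> R) (s : R) (t : I -> R) :
  has_sum F s -> (forall i, has_sum (fun j => F (i, j)) (t i)) -> has_sum t s.
Proof.
move=> /has_sumP HF Ht; apply/has_sumP => e e0.
have e2 : 0 < e / 2 by rewrite divr_gt0.
have [A HA] := HF _ e2; exists [fset p.1 | p in A]%fset => B /fsubsetP AB.
apply: (@le_lt_trans _ _ (e / 2)); last by lra.
apply/ler_addgt0Pr => d d0.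
have [J0 HJ] := proj1 (has_sumP _ _)
  (has_sum_sum (r := B) (F := fun i j => F (i, j)) Ht) d d0.
pose K := (J0 `|` [fset p.2 | p in A])%fset.
have /ltW h1 := HJ K (fsubsetUl _ _).
have /HA/ltW : (A `<=` B `*` K)%fset.
  apply/fsubsetP => p pA; rewrite in_fsetM AB ?inE; last first.
    by apply/imfsetP; exists p.
  by apply/orP; right; apply/imfsetP; exists p.
rewrite sum_fsetM exchange_big/= => h2.
rewrite -(subrK (\sum_(j <- K) \sum_(i <- B) F (i, j)) s) -addrA.
by rewrite (le_trans (ler_normD _ _))// lerD// distrC.
Qed.

(** Absolute summability of a double family, from that of bounds of its row
    sums. *)
Lemma abs_summable_prod (I J : choiceType) (F : I * J -> R) (T : I -> R) :
  (forall i (B : {fset J}), \sum_(j <- B) `|F (i, j)| <= T i) ->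
  abs_summable T -> abs_summable F.
Proof.
move=> HT [M HM]; exists M => A.
apply: (@le_trans _ _ (\sum_(p <-
    ([fset p.1 | p in A] `*` [fset p.2 | p in A])%fset) `|F p|)).
  apply: big_fset_subset_le => //; apply/fsubsetP => p pA.
  by rewrite in_fsetM; apply/andP; split; apply/imfsetP; exists p.
rewrite sum_fsetM; apply: le_trans (HM [fset p.1 | p in A]%fset).
by apply: ler_sum => i _; apply: (le_trans (HT i _)); exact: ler_norm.
Qed.

Lemma has_sum_ge_partial (I : choiceType) (a : I -> R) (s : R) (A : {fset I}) :
  (forall i, 0 <= a i) -> has_sum a s -> \sum_(i <- A) a i <= s.
Proof.
move=> a0 /has_sumP H; apply/ler_addgt0Pr => e e0; have [B HB] := H e e0.
have := HB (A `|` B)%fset (fsubsetUr _ _).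
have := big_fset_subset_le a0 (fsubsetUl A B).
rewrite ltr_distlC => h /andP[_ h']; lra.
Qed.

Lemma abs_summable_inj (I J : choiceType) (f : J -> I) (a : I -> R) :
  injective f -> abs_summable a -> abs_summable (a \o f).
Proof.
move=> finj [M HM]; exists M => A.
apply: le_trans (HM [fset f j | j in A]%fset).
by rewrite big_imfset//= => x y _ _; exact: finj.
Qed.

End Summation.

(** * Multiple power series *)

Section PowerSeries.
Variables (R : realType) (m : nat).
Implicit Types (a b : {ffun 'I_m -> nat} -> R) (y r : 'I_m -> R).
Implicit Types (al be : {ffun 'I_m -> nat}).

(** The multi-indices all of whose entries are less than [N]. *)
Definition box (N : nat) : {fset {ffun 'I_m -> nat}} :=
  [fset al in codom (fun be : {ffun 'I_m -> 'I_N} =>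
     [ffun i => val (be i)])]%fset.

Lemma in_box N al : (al \in box N) = [forall i, (al i < N)%N].
Proof.
rewrite in_fset; apply/codomP/forallP => [[be ->] i|H].
  by rewrite ffunE ltn_ord.
exists [ffun i => Ordinal (H i)].
by apply/ffunP => i; rewrite !ffunE.
Qed.

Lemma sum_box N (F : 'I_m -> nat -> R) :
  \sum_(al <- box N) \prod_i F i (al i) = \prod_i \sum_(k < N) F i k.
Proof.
rewrite bigA_distr_bigA/=.
pose f (be : {ffun 'I_m -> 'I_N}) : {ffun 'I_m -> nat} :=
  [ffun i => val (be i)].
have finj : injective f.
  move=> be be' /ffunP H; apply/ffunP => i; apply/val_inj.
  by have := H i; rewrite !ffunE.
rewrite (perm_big (codom f)) /=; last first.
  apply: uniq_perm; first exact: fset_uniq.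
    by rewrite map_inj_uniq ?enum_uniq.
  by move=> al; rewrite in_fset.
rewrite big_map big_enum/=; apply: eq_bigr => be _.
by apply: eq_bigr => i _; rewrite ffunE.
Qed.

Lemma box_cover (A : {fset {ffun 'I_m -> nat}}) :
  exists N, (A `<=` box N)%fset.
Proof.
exists (\max_(al <- A) \max_i al i).+1; apply/fsubsetP => al alA.
rewrite in_box; apply/forallP => i; rewrite ltnS.
apply: (leq_trans (leq_bigmax (F := al) i)).
exact: (@leq_bigmax_seq _ _ xpredT
  (fun al : {ffun 'I_m -> nat} => \max_i al i)).
Qed.

Lemma geometric_partial_le (t : R) N : 0 <= t < 1 ->
  \sum_(k < N) t ^+ k <= (1 - t)^-1.
Proof.
move=> /andP[t0 t1]; have h : 0 < 1 - t by rewrite subr_gt0.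
rewrite -(ler_pM2l h) divff ?gt_eqF//.
have -> : (1 - t) * \sum_(k < N) t ^+ k = 1 - t ^+ N.
  rewrite -[in RHS](expr1n _ N) subrXX; congr (_ * _).
  by apply: eq_bigr => i _; rewrite expr1n mul1r.
by rewrite gerBl exprn_ge0.
Qed.

Lemma geometric_abs_summable y : (forall i, 0 <= y i < 1) ->
  abs_summable (fun al => \prod_i y i ^+ al i).
Proof.
move=> Hy; exists (\prod_i (1 - y i)^-1) => A; have [N AN] := box_cover A.
have y0 i : 0 <= y i by case/andP: (Hy i).
apply: (le_trans (big_fset_subset_le _ AN)) => //.
rewrite (eq_bigr (fun al => \prod_i y i ^+ al i)); last first.
  by move=> al _; rewrite ger0_norm// prodr_ge0// => i _; exact: exprn_ge0.
rewrite (sum_box N (fun i k => y i ^+ k)).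
apply: ler_prod => i _; rewrite geometric_partial_le// andbT.
by apply: sumr_ge0 => k _; exact: exprn_ge0.
Qed.

(** The term of index [al] of the power series with coefficients [a]. *)
Definition pterm a y al : R := a al * \prod_i y i ^+ al i.

(** Cauchy's estimates for the polyradius [r], with an unspecified
    constant. *)
Definition dominated a r : Prop :=
  exists M, forall al, `|a al| * \prod_i r i ^+ al i <= M.

Lemma norm_pterm a y al : `|pterm a y al| = `|a al| * \prod_i `|y i| ^+ al i.
Proof.
rewrite normrM normr_prod; congr (_ * _).
by apply: eq_bigr => i _; rewrite normrX.
Qed.

(** Abel's lemma. *)
Lemma dominated_abs_summable a r y : dominated a r ->
  (forall i, `|y i| < r i) -> abs_summable (pterm a y).
Proof.
move=> [M HM] yr.
have r0 i : 0 < r i by apply: le_lt_trans (yr i).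
apply: (@abs_summable_le _ _ _
  (fun al => M * \prod_i (`|y i| / r i) ^+ al i)).
  move=> al; rewrite norm_pterm.
  have -> : \prod_i `|y i| ^+ al i =
      \prod_i r i ^+ al i * \prod_i (`|y i| / r i) ^+ al i.
    rewrite -big_split/=; apply: eq_bigr => i _.
    by rewrite -exprMn mulrC divfK// gt_eqF.
  rewrite mulrA ler_wpM2r// prodr_ge0// => i _.
  by rewrite exprn_ge0// divr_ge0// ltW.
apply: abs_summableZ; apply: geometric_abs_summable => i.
by rewrite divr_ge0 ?(ltW (r0 i))//= ltr_pdivrMr ?mul1r.
Qed.

Lemma has_sum_dominated a r s : (forall i, 0 <= r i) ->
  has_sum (pterm a r) s -> dominated a r.
Proof.
move=> r0 /has_sum_bounded[M HM]; exists M => al; apply: le_trans (HM al).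
by rewrite norm_pterm; under [X in _ <= _ * X]eq_bigr do rewrite ger0_norm//.
Qed.

(** The binomial formula, as a sum over all multi-indices. *)
Lemma has_sum_binomial y z al :
  has_sum (fun be => \prod_i
      ((y i ^+ (al i - be i) * z i ^+ be i) *+ 'C(al i, be i)))
    (\prod_i (y i + z i) ^+ al i).
Proof.
have [N] := box_cover [fset al]%fset; rewrite fsub1set in_box => /forallP alN.
have -> : \prod_i (y i + z i) ^+ al i =
    \sum_(be <- box N) \prod_i
      ((y i ^+ (al i - be i) * z i ^+ be i) *+ 'C(al i, be i)).
  pose F i k := (y i ^+ (al i - k) * z i ^+ k) *+ 'C(al i, k).
  rewrite (sum_box N F).
  apply: eq_bigr => i _; rewrite exprDn.
  rewrite (big_ord_widen N (F i))//.
  rewrite big_mkcond/=; apply: eq_bigr => k _; case: ifPn => //.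
  by rewrite -leqNgt /F => kal; rewrite bin_small.
apply: has_sum_finite => be; rewrite in_box negb_forall => /existsP[i].
rewrite -leqNgt => Nb; rewrite (bigD1 i)//= bin_small ?mulr0n ?mul0r//.
exact: leq_trans (alN i) Nb.
Qed.

(** Taylor expansion of a power series about a point [q] of its domain of
    convergence: the binomial formula turns the series into a double series,
    which is then summed in the other order. *)
Lemma taylor a r q : dominated a r -> (forall i, `|q i| < r i) ->
  exists b,
    (forall be, has_sum
       (fun al => a al * \prod_i (q i ^+ (al i - be i) *+ 'C(al i, be i)))
       (b be)) /\
    forall z s, (forall i, `|q i| + `|z i| < r i) ->
      has_sum (pterm a (fun i => q i + z i)) s -> has_sum (pterm b z) s.
Proof.
move=> ar qr.
pose F z (p : {ffun 'I_m -> nat} * {ffun 'I_m -> nat}) :=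
  a p.1 * \prod_i ((q i ^+ (p.1 i - p.2 i) * z i ^+ p.2 i) *+ 'C(p.1 i, p.2 i)).
have FE z al be : F z (al, be) = (\prod_i z i ^+ be i) *
    (a al * \prod_i (q i ^+ (al i - be i) *+ 'C(al i, be i))).
  rewrite /F/= mulrCA; congr (_ * _); rewrite -big_split/=.
  by apply: eq_bigr => i _; rewrite mulrnAr mulrC.
have Fsum z : (forall i, `|q i| + `|z i| < r i) -> abs_summable (F z).
  move=> Hz; apply: (abs_summable_prod
      (T := fun al => `|pterm a (fun i => `|q i| + `|z i|) al|)).
    move=> al B; rewrite norm_pterm.
    have Fn be : `|F z (al, be)| = `|a al| *
        \prod_i ((`|q i| ^+ (al i - be i) * `|z i| ^+ be i) *+ 'C(al i, be i)).
      rewrite normrM normr_prod; congr (_ * _); apply: eq_bigr => i _.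
      by rewrite normrMn normrM !normrX.
    rewrite (eq_bigr _ (fun be _ => Fn be)) -big_distrr/= ler_wpM2l//.
    under [leRHS]eq_bigr do rewrite ger0_norm ?addr_ge0//.
    apply: has_sum_ge_partial; last exact: has_sum_binomial.
    move=> be; apply: prodr_ge0 => i _.
    by rewrite mulrn_wge0// mulr_ge0// exprn_ge0.
  apply: (@abs_summable_le _ _ _
      (fun al => `|pterm a (fun i => `|q i| + `|z i|) al|)).
    by move=> al; rewrite normr_id.
  have [M HM] : abs_summable (pterm a (fun i => `|q i| + `|z i|)).
    apply: (dominated_abs_summable ar) => i.
    by rewrite ger0_norm ?addr_ge0.
  by exists M => A; under eq_bigr do rewrite normr_id.
(* The coefficients are read off at one point [z0] with nonzero coordinates. *)
have [z0 z0gt Hz0] : exists2 z0 : 'I_m -> R, (forall i, 0 < z0 i) &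
    forall i, `|q i| + `|z0 i| < r i.
  exists (fun i => (r i - `|q i|) / 2) => i /=; have h := qr i; first lra.
  rewrite [X in _ + X]ger0_norm; lra.
have /choice[b Hb] : forall be, exists t, has_sum
     (fun al => a al * \prod_i (q i ^+ (al i - be i) *+ 'C(al i, be i))) t.
  move=> be.
  have [] := @abs_summable_has_sum _ _ (F z0 \o (fun al => (al, be))).
    by apply: abs_summable_inj (Fsum _ Hz0) => ? ? [].
  move=> t /(has_sumZ (k := (\prod_i z0 i ^+ be i)^-1)) H.
  exists ((\prod_i z0 i ^+ be i)^-1 * t); apply: has_sum_eq H => // al /=.
  rewrite FE mulKf//; apply/prodf_neq0 => i _.
  by rewrite expf_neq0// gt_eqF.
exists b; split => // z s Hz Hs.
have [S HS] := abs_summable_has_sum (Fsum _ Hz).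
have <- : S = s.
  apply: has_sum_unique Hs; apply: (has_sum_fubini HS) => al.
  apply: has_sum_eq (has_sumZ (k := a al) (@has_sum_binomial q z al)) => //.
pose sw (p : {ffun 'I_m -> nat} * {ffun 'I_m -> nat}) := (p.2, p.1).
have HS' : has_sum (F z \o sw) S.
  apply: (proj1 (has_sum_reindex _ _ _) HS).
    by move=> [? ?] [? ?] [-> ->].
  by move=> [? ?] _; eexists (_, _).
apply: (has_sum_fubini HS') => be /=.
apply: has_sum_eq (has_sumZ (k := \prod_i z i ^+ be i) (Hb be)) => [al|].
  by rewrite /= FE.
by rewrite mulrC.
Qed.

(** The multi-index of the [i]-th coordinate. *)
Definition unit_index (i : 'I_m) : {ffun 'I_m -> nat} :=
  [ffun j => (j == i) : nat].

(** The multi-index [al] with its [i]-th entry increased by one. *)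
Definition raise (i : 'I_m) al : {ffun 'I_m -> nat} :=
  [ffun j => (al j + (j == i))%N].

(** The coefficients of the [i]-th partial derivative of a power series. *)
Definition dcoef (i : 'I_m) a : {ffun 'I_m -> nat} -> R :=
  fun al => (al i).+1%:R * a (raise i al).

Lemma raise_inj i : injective (raise i).
Proof.
move=> al be /ffunP H; apply/ffunP => j; have := H j.
by rewrite !ffunE => /addIn.
Qed.

Lemma raise_surj i al : (0 < al i)%N -> exists be, raise i be = al.
Proof.
move=> h; exists [ffun j => (al j - (j == i))%N]; apply/ffunP => j.
by rewrite !ffunE; case: eqP => [->|_]; rewrite ?subnK// subn0 addn0.
Qed.

(** The first order coefficients of the re-expansion given by [taylor] are
    the values of the partial derivatives. *)
Lemma dcoef_sum i a q s :
  has_sum (fun al => a al * \prod_j (q j ^+ (al j - unit_index i j) *+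
    'C(al j, unit_index i j))) s ->
  has_sum (pterm (dcoef i a) q) s.
Proof.
move=> H.
pose f al := a al *
  \prod_j (q j ^+ (al j - unit_index i j) *+ 'C(al j, unit_index i j)).
have : has_sum (f \o raise i) s.
  apply: (proj1 (has_sum_reindex _ _ _) H); first exact: raise_inj.
  move=> al fal; apply: raise_surj; rewrite lt0n; apply: contra fal => /eqP h.
  by rewrite /f (bigD1 i)//= ffunE eqxx h mulr0n mul0r mulr0.
apply: has_sum_eq => // al; rewrite /f/pterm/dcoef/=.
suff -> : \prod_j (q j ^+ (raise i al j - unit_index i j) *+
      'C(raise i al j, unit_index i j)) = (al i).+1%:R * \prod_j q j ^+ al j.
  by rewrite mulrCA mulrA.
rewrite (bigD1 i)//= [X in _ = _ * X](bigD1 i)//= mulrA !ffunE eqxx addnK bin1.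
rewrite addn1 -mulr_natl; congr (_ * _).
by apply: eq_bigr => j /negbTE ji; rewrite !ffunE ji addn0 subn0 bin0.
Qed.

Lemma has_sum_center a : has_sum (pterm a (fun=> 0)) (a [ffun=> 0%N]).
Proof.
apply: has_sum_eq (has_sum_finite (A := [fset [ffun=> 0%N]]%fset) _).
- by [].
- rewrite big_seq_fset1 /pterm big1 ?mulr1// => i _.
  by rewrite ffunE expr0.
- move=> al; rewrite in_fset1 => al0; rewrite /pterm.
  have [i ali] : exists i, al i != 0%N.
    apply/existsP; apply: contraNT al0; rewrite negb_exists => /forallP H.
    by apply/eqP/ffunP => i; rewrite ffunE; apply/eqP/negPn/H.
  by rewrite (bigD1 i)//= expr0n (negbTE ali) mul0r mulr0.
Qed.

End PowerSeries.

(** * Power series expansions of functions of several variables *)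

Section Expansions.
Variables (R : realType) (m : nat).
Implicit Types (a b : {ffun 'I_m -> nat} -> R) (p q x : 'rV[R]_m).
Implicit Types (f g : 'rV[R]_m -> R).

Lemma near_rowP p (P : 'rV[R]_m -> Prop) :
  (\forall x \near p, P x) <->
  exists2 e : R, 0 < e & forall x, (forall i, `|x 0 i - p 0 i| < e) -> P x.
Proof.
split=> [/nbhs_ballP[e e0 H]|[e e0 H]].
  exists e => // x Hx; apply: H; split=> // i j; rewrite (ord1 i).
  by rewrite -ball_normE/= distrC.
apply/nbhs_ballP; exists e => // x [_ Hx]; apply: H => i.
by have := Hx 0 i; rewrite -ball_normE/= distrC.
Qed.

Lemma common_radius (d : 'I_m -> R) : (forall i, 0 < d i) ->
  exists2 e : R, 0 < e & forall i, e <= d i.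
Proof.
move=> d0; exists (\big[Order.min/1]_i d i).
  by apply: lt_bigmin => // i _; exact: d0.
by move=> i; exact: bigmin_le.
Qed.

(** On a neighbourhood of [p], [f] is the sum of the power series centred at
    [p] with coefficients [a]. *)
Definition expands f p a : Prop :=
  \forall x \near p,
    has_sum (pterm a (fun i => (x : 'rV[R]_m) 0 i - p 0 i)) (f x).

Lemma expands_eq f g p a b : (\forall x \near p, f x = g x) -> a =1 b ->
  expands f p a -> expands g p b.
Proof.
move=> fg /funext <-; apply: filterS2 fg => x -> //.
Qed.

Lemma expandsD f g p a b : expands f p a -> expands g p b ->
  expands (fun x => f x + g x) p (fun al => a al + b al).
Proof.
apply: filterS2 => x Hf Hg; apply: has_sum_eq (has_sumD Hf Hg) => // al.
by rewrite /pterm mulrDl.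
Qed.

Lemma expandsZ f p a k : expands f p a ->
  expands (fun x => k * f x) p (fun al => k * a al).
Proof.
apply: filterS => x Hf; apply: has_sum_eq (has_sumZ (k := k) Hf) => // al.
by rewrite /pterm mulrA.
Qed.

Lemma expandsB f g p a b : expands f p a -> expands g p b ->
  expands (fun x => f x - g x) p (fun al => a al - b al).
Proof.
move=> Hf /(expandsZ (-1)) Hg.
apply: expands_eq (expandsD Hf Hg) => [|al]; last by rewrite mulN1r.
by apply/near_rowP; exists 1 => // x _; rewrite mulN1r.
Qed.

(** An expansion near [p] satisfies Cauchy's estimates on a polydisc on which
    it is valid. *)
Lemma expands_dominated f p a : expands f p a ->
  exists2 e : R, 0 < e & dominated a (fun=> e) /\
    forall x, (forall i, `|x 0 i - p 0 i| < e) ->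
      has_sum (pterm a (fun i => x 0 i - p 0 i)) (f x).
Proof.
move=> /near_rowP[e e0 He]; exists (e / 2); first by rewrite divr_gt0.
split; last first.
  by move=> x Hx; apply: He => i; apply: (lt_trans (Hx i)); lra.
have := He (p + const_mx (e / 2)) => H.
apply: (@has_sum_dominated _ _ _ _ (f (p + const_mx (e / 2)))).
  by move=> i; lra.
apply: (has_sum_eq _ _ (H _)) => //.
  move=> al; congr (_ * _); apply: eq_bigr => i _.
  by rewrite !mxE addrAC subrr add0r.
by move=> i; rewrite !mxE addrAC subrr add0r ger0_norm; lra.
Qed.

(** A power series is analytic on its polydisc of convergence; the first order
    coefficients of its expansion at [q] are the values at [q] of the
    differentiated series. *)
Lemma polydisc_expands f p a (r : 'I_m -> R) q :
  dominated a r ->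
  (forall x, (forall i, `|x 0 i - p 0 i| < r i) ->
     has_sum (pterm a (fun i => x 0 i - p 0 i)) (f x)) ->
  (forall i, `|q 0 i - p 0 i| < r i) ->
  exists b, expands f q b /\
    forall i, has_sum (pterm (dcoef i a) (fun j => q 0 j - p 0 j))
      (b (unit_index i)).
Proof.
move=> ar Hf qr; have [b [Hb Hbs]] := taylor ar qr.
exists b; split; last by move=> i; apply: dcoef_sum; exact: Hb.
have [|e e0 He] := @common_radius (fun i => r i - `|q 0 i - p 0 i|).
  by move=> i; rewrite subr_gt0.
apply/near_rowP; exists e => // x Hx; apply: Hbs.
  by move=> i; have := He i; have := Hx i; lra.
have -> : (fun i => q 0 i - p 0 i + (x 0 i - q 0 i)) = fun i => x 0 i - p 0 i.
  by apply/funext => i; ring.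
apply: Hf => i; have := He i; have := Hx i.
have := ler_normD (x 0 i - q 0 i) (q 0 i - p 0 i); rewrite addrA subrK; lra.
Qed.

(** The partial derivatives at the centre are the first order coefficients:
    along the [i]-th axis, the terms of order at least two sum to a quantity
    that is quadratic in the increment. *)
Lemma expands_pderiv_center f q b i : expands f q b ->
  pderiv i f q = b (unit_index i).
Proof.
move=> /expands_dominated[d d0 [bd Hf]].
pose y (h : R) := fun j : 'I_m => if j == i then h else 0.
have fh h : `|h| < d ->
    has_sum (pterm b (y h)) (f (h *: delta_mx 0 i + q)).
  move=> hd; apply: has_sum_eq (Hf (h *: delta_mx 0 i + q) _) => //.
    move=> al; congr (_ * _); apply: eq_bigr => j _.
    rewrite !mxE addrK eqxx /y /=.
    by case: (j == i); rewrite ?mulr1 ?mulr0.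
  move=> j; rewrite !mxE addrK eqxx /=.
  by case: (j == i); rewrite ?mulr1 ?mulr0 ?normr0.
pose A := [fset [ffun=> 0%N]; unit_index i]%fset.
have d2 : `|d / 2| < d by rewrite ger0_norm; lra.
have [M HM] : abs_summable (pterm b (y (d / 2))).
  apply: (dominated_abs_summable bd) => j; rewrite /y; case: eqP => // _.
  by rewrite normr0.
have f0 : f q = b [ffun=> 0%N].
  apply: has_sum_unique (@has_sum_center _ _ b).
  have := fh 0; rewrite normr0 scale0r add0r => /(_ d0).
  apply: has_sum_eq => // al; congr (_ * _); apply: eq_bigr => j _.
  by rewrite /y; case: eqP.
have ui0 : [ffun=> 0%N] != unit_index i.
  by apply/eqP => /ffunP/(_ i); rewrite !ffunE eqxx.
have remainder h : `|h| <= d / 2 ->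
    `|f (h *: delta_mx 0 i + q) - f q - h * b (unit_index i)|
      <= (`|h| / (d / 2)) ^+ 2 * M.
  move=> hd.
  have hd' : `|h| < d by lra.
  have HA : has_sum (fun al => if al \in A then pterm b (y h) al else 0)
      (f q + h * b (unit_index i)).
    apply: has_sum_eq (has_sum_finite (A := A) _) => //; last first.
      by move=> al /negbTE ->.
    rewrite big_fsetU1/=; last by rewrite in_fset1.
    rewrite big_seq_fset1 !inE !eqxx orbT /= f0; congr (_ + _).
      by rewrite /pterm big1 ?mulr1// => j _; rewrite ffunE expr0.
    rewrite /pterm mulrC (bigD1 i)//= big1 ?mulr1.
      by rewrite ffunE eqxx /y eqxx expr1.
    by move=> j /negbTE ji; rewrite ffunE ji expr0.
  have := has_sumB (fh h hd') HA; rewrite opprD addrA => H.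
  apply: (has_sum_le (A0 := fset0) H) => B _.
  apply: (le_trans (ler_norm_sum _ _ _)).
  apply: (@le_trans _ _ (\sum_(al <- B)
      (`|h| / (d / 2)) ^+ 2 * `|pterm b (y (d / 2)) al|)); last first.
    by rewrite -big_distrr/= ler_wpM2l// exprn_ge0// divr_ge0//; lra.
  apply: ler_sum => al _; case: ifPn => [_|].
    by rewrite subrr normr0 mulr_ge0// exprn_ge0// divr_ge0//; lra.
  rewrite !inE negb_or subr0 !norm_pterm => /andP[al0 ali].
  rewrite mulrCA ler_wpM2l//.
  have [[j [ji alj]]|] := pselect (exists j, j != i /\ al j != 0%N).
    rewrite (bigD1 j)//= /y (negbTE ji) normr0 expr0n (negbTE alj) mul0r.
    by rewrite mulr_ge0 ?prodr_ge0// exprn_ge0// divr_ge0//; lra.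
  move=> Hj.
  have alj j : j != i -> al j = 0%N.
    by move=> ji; apply/eqP/negPn/negP => ?; apply: Hj; exists j.
  have prodE t : \prod_j `|y t j| ^+ al j = `|t| ^+ al i.
    rewrite (bigD1 i)//= big1 ?mulr1 /y ?eqxx// => j ji.
    by rewrite alj.
  rewrite !prodE (ger0_norm (_ : 0 <= d / 2)); last by lra.
  have [k alk] : exists k, al i = k.+2.
    case E : (al i) => [|[|k]]; last by exists k.
      case/negP: al0; apply/eqP/ffunP => j; rewrite ffunE.
      by have [->|/alj] := eqVneq j i.
    case/negP: ali; apply/eqP/ffunP => j; rewrite ffunE.
    by have [->|/alj] := eqVneq j i.
  rewrite alk -addn2 !exprD [leRHS]mulrCA -exprMn divfK; last first.
    by rewrite gt_eqF//; lra.
  by rewrite ler_wpM2r ?exprn_ge0// lerXn2r// nnegrE; lra.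
have M0 : 0 <= M by apply: le_trans (HM fset0); exact: sumr_ge0.
apply: cvg_lim => //.
apply/cvgrPdist_le => e e0.
pose C := M / (d / 2) ^+ 2 + 1.
have C0 : 0 < C by rewrite ltr_wpDl// divr_ge0// exprn_ge0//; lra.
near=> h.
have h0 : h != 0 by near: h; exact: nbhs_dnbhs_neq.
have h1 : `|h| < d / 2.
  near: h; apply: dnbhs0_lt; lra.
have h2 : `|h| < e / C.
  near: h; apply: dnbhs0_lt; exact: divr_gt0.
have H := remainder h (ltW h1).
have hpos : 0 < `|h| by rewrite normr_gt0.
rewrite distrC.
have -> : h^-1 *: ((f \o shift q) (h *: delta_mx 0 i) - f q) -
    b (unit_index i) =
   h^-1 * (f (h *: delta_mx 0 i + q) - f q - h * b (unit_index i)).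
  by rewrite /= mulrBr mulKf.
rewrite normrM normfV mulrC ler_pdivrMr//; apply: (le_trans H).
have -> : (`|h| / (d / 2)) ^+ 2 * M = (M / (d / 2) ^+ 2) * `|h| * `|h|.
  by rewrite expr_div_n; ring.
rewrite ler_wpM2r//.
rewrite (@le_trans _ _ (C * `|h|))//; first by rewrite ler_wpM2r// /C; lra.
by rewrite mulrC -ler_pdivlMr// ltW.
Unshelve. all: by end_near.
Qed.

End Expansions.

Section ExpansionTheory.
Variables (R : realType) (m : nat).
Implicit Types (a b : {ffun 'I_m -> nat} -> R) (p q x : 'rV[R]_m).
Implicit Types (al be : {ffun 'I_m -> nat}).
Implicit Types (f g : 'rV[R]_m -> R).

Lemma polydisc_pderiv f p a (r : 'I_m -> R) q i :
  dominated a r ->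
  (forall x, (forall i, `|x 0 i - p 0 i| < r i) ->
     has_sum (pterm a (fun i => x 0 i - p 0 i)) (f x)) ->
  (forall i, `|q 0 i - p 0 i| < r i) ->
  has_sum (pterm (dcoef i a) (fun j => q 0 j - p 0 j)) (pderiv i f q).
Proof.
move=> ar Hf qr; have [b [fb Hb]] := polydisc_expands ar Hf qr.
by rewrite (expands_pderiv_center i fb).
Qed.

(** Term by term differentiation. *)
Lemma expands_pderiv f p a i :
  expands f p a -> expands (pderiv i f) p (dcoef i a).
Proof.
move=> /expands_dominated[e e0 [ae Hf]]; apply/near_rowP; exists e => // q qe.
exact: (polydisc_pderiv ae Hf qe).
Qed.

Lemma expands_const p (k : R) :
  expands (fun=> k) p (fun al => if al == [ffun=> 0%N] then k else 0).
Proof.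
apply/near_rowP; exists 1 => // x _.
apply: has_sum_eq (has_sum_finite (A := [fset [ffun=> 0%N]]%fset) _).
- by [].
- rewrite big_seq_fset1 /pterm eqxx big1 ?mulr1// => i _.
  by rewrite ffunE expr0.
- by move=> al; rewrite in_fset1 /pterm => /negbTE ->; rewrite mul0r.
Qed.

(** By induction on the degree of the monomial, since the derivatives of the
    zero function vanish too. *)
Lemma expands0_coef n : forall a p al, expands (fun=> 0) p a ->
  (\sum_i al i)%N = n -> a al = 0.
Proof.
elim: n => [|n IH] a p al a0 Hal.
  have -> : al = [ffun=> 0%N].
    apply/ffunP => i; rewrite ffunE; apply/eqP; rewrite -leqn0 -Hal.
    by rewrite (bigD1 i)//= leq_addr.
  apply: has_sum_unique (@has_sum_center _ _ a) _.
  have /near_rowP[e e0 H] := a0.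
  apply: (has_sum_eq _ _ (H p _)) => //.
  + by move=> be; congr (_ * _); apply: eq_bigr => i _; rewrite subrr.
  + by move=> i; rewrite subrr normr0.
have [i ali] : exists i, (0 < al i)%N.
  apply/existsP; apply: contraPT Hal; rewrite negb_exists => /forallP H.
  by rewrite big1// => i _; have := H i; rewrite lt0n negbK => /eqP.
have [be bei] := raise_surj ali.
have : dcoef i a be = 0.
  apply: (IH (dcoef i a) p).
    apply: expands_eq (expands_pderiv i a0) => //.
    by apply/near_rowP; exists 1 => // x _; exact: derive_cst.
  move: Hal; rewrite -bei (eq_bigr (fun j => be j + (j == i))%N); last first.
    by move=> j _; rewrite ffunE.
  rewrite big_split/= [X in (_ + X)%N](bigD1 i)//= eqxx.
  rewrite [X in (_ + (_ + X))%N]big1; last by move=> j /negbTE ->.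
  by rewrite addn0 addn1 => -[].
by move=> /eqP; rewrite mulf_eq0 pnatr_eq0/= bei => /eqP.
Qed.

(** The coefficients of an expansion are determined by the function. *)
Lemma expands_unique f p a b : expands f p a -> expands f p b -> a =1 b.
Proof.
move=> fa fb al; apply/eqP; rewrite -subr_eq0; apply/eqP.
apply: (expands0_coef (a := fun al => a al - b al) (p := p) _ erefl).
apply: expands_eq (expandsB fa fb) => //.
by apply/near_rowP; exists 1 => // x _; rewrite subrr.
Qed.

End ExpansionTheory.

(** * Restriction to coordinate subspaces *)

Section Restriction.
Variables (R : realType) (k m : nat) (h : 'I_k -> 'I_m).
Hypothesis hinj : injective h.
Implicit Types (a : {ffun 'I_m -> nat} -> R).

(** Extension of a multi-index by zero along [h].  The sum has one term for
    [i] in the image of [h], and none otherwise. *)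
Definition ext_index (be : {ffun 'I_k -> nat}) : {ffun 'I_m -> nat} :=
  [ffun i => \sum_(j | h j == i) be j]%N.

Lemma ext_indexE be j : ext_index be (h j) = be j.
Proof. by rewrite ffunE (big_pred1 j)// => j'; rewrite (inj_eq hinj). Qed.

Lemma ext_index_out be i : (forall j, h j != i) -> ext_index be i = 0%N.
Proof. by move=> H; rewrite ffunE big_pred0// => j; exact/negbTE. Qed.

Lemma ext_index_inj : injective ext_index.
Proof.
by move=> be be' e; apply/ffunP => j; rewrite -!ext_indexE e.
Qed.

Lemma ext_index_surj (al : {ffun 'I_m -> nat}) :
  (forall i, (forall j, h j != i) -> al i = 0%N) ->
  exists be, ext_index be = al.
Proof.
move=> H; exists [ffun j => al (h j)]; apply/ffunP => i.
have [[j <-]|ni] := pselect (exists j, h j = i).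
  by rewrite ext_indexE ffunE.
have Hi j : h j != i by apply/eqP => hj; apply: ni; exists j.
by rewrite ext_index_out// H.
Qed.

Lemma prod_ext_index (z : 'I_m -> R) be :
  \prod_i z i ^+ ext_index be i = \prod_j z (h j) ^+ be j.
Proof.
rewrite [RHS](partition_big h xpredT)//=; apply: eq_bigr => i _.
rewrite ffunE -prodrXr; apply: eq_bigr => j /eqP ->//.
Qed.

(** A power series restricts to the coordinate subspace on which only the
    variables [h j] survive. *)
Lemma has_sum_ext_index a (z : 'I_m -> R) s :
  (forall al, (forall be, ext_index be <> al) -> pterm a z al = 0) ->
  has_sum (pterm a z) s <->
  has_sum (pterm (a \o ext_index) (fun j => z (h j))) s.
Proof.
move=> H.
have -> : pterm (a \o ext_index) (fun j => z (h j)) = pterm a z \o ext_index.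
  by apply/funext => be; rewrite /pterm/= prod_ext_index.
apply: has_sum_reindex; first exact: ext_index_inj.
move=> al; apply: contraPP => /forallNP al0; apply/negP; rewrite negbK.
by apply/eqP; exact: H.
Qed.

(** [L] parametrizes the coordinate subspace through [p] in the directions
    [h j]. *)
Lemma expands_restrict (f : 'rV[R]_m -> R) (L : 'rV[R]_k -> 'rV[R]_m)
    (p : 'rV[R]_m) (p' : 'rV[R]_k) a :
  (forall y j, (L y) 0 (h j) - p 0 (h j) = y 0 j - p' 0 j) ->
  (forall y i, (forall j, h j != i) -> (L y) 0 i = p 0 i) ->
  expands f p a -> expands (f \o L) p' (a \o ext_index).
Proof.
move=> Lh Lo /near_rowP[e e0 H]; apply/near_rowP; exists e => // y Hy.
have HL i : (exists j, h j = i) \/ (forall j, h j != i).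
  have [|ni] := pselect (exists j, h j = i); first by left.
  by right => j; apply/eqP => hj; apply: ni; exists j.
have Hs : has_sum (pterm a (fun i => (L y) 0 i - p 0 i)) (f (L y)).
  apply: H => i.
  by have [[j <-]|/Lo ->] := HL i; rewrite ?Lh// subrr normr0.
have H0 al : (forall be, ext_index be <> al) ->
    pterm a (fun i => (L y) 0 i - p 0 i) al = 0.
  move=> Hal; have [i [Hi ali]] : exists i, (forall j, h j != i) /\ al i != 0%N.
    apply: contrapT => /forallNP N.
    have [be /Hal//] : exists be, ext_index be = al.
    apply: ext_index_surj => i Hi; apply/eqP/negPn/negP => ali.
    by apply: (N i).
  by rewrite /pterm (bigD1 i)//= Lo// subrr expr0n (negbTE ali) mul0r mulr0.
have <- : (fun j => (L y) 0 (h j) - p 0 (h j)) = (fun j => y 0 j - p' 0 j).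
  by apply/funext => j; rewrite Lh.
exact: (proj1 (has_sum_ext_index _ H0) Hs).
Qed.

End Restriction.

(** * The formal solution *)

Lemma ord3P (P : 'I_3 -> Prop) : P 0 -> P 1 -> P 2 -> forall k, P k.
Proof.
move=> P0 P1 P2 [[|[|[|//]]] hk].
- by have -> : Ordinal hk = 0 by exact/val_inj.
- by have -> : Ordinal hk = 1 by exact/val_inj.
- by have -> : Ordinal hk = 2 by exact/val_inj.
Qed.

Lemma sum_ord3 (R : realType) (F : 'I_3 -> R) : \sum_i F i = F 0 + F 1 + F 2.
Proof.
rewrite !big_ord_recr big_ord0 /= add0r.
by congr (F _ + F _ + F _); exact/val_inj.
Qed.

Lemma trinomial_le (l m n : nat) :
  ((l + m + n)`! <= 4 ^ (l + m + n) * (l`! * m`! * n`!))%N.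
Proof.
have binl N k : ('C(N, k) <= 2 ^ N)%N.
  have [kN|/bin_small ->//] := leqP k N.
  rewrite -[2%N]/(1 + 1)%N expnDn (bigD1 (Ordinal (kN : (k < N.+1)%N)))//=.
  by rewrite !exp1n !muln1 leq_addr.
have E : ((l + m + n)`! =
    'C(l + m + n, n) * 'C(l + m, l) * (l`! * m`! * n`!))%N.
  have := @bin_fact (l + m + n) n (leq_addl _ _); rewrite addnK => <-.
  have := @bin_fact (l + m) l (leq_addr _ _); rewrite addKn => <-.
  by ring.
rewrite E leq_mul2r; apply/orP; right.
rewrite -[4%N]/(2 * 2)%N expnMn leq_mul//.
by apply: leq_trans (binl _ _) _; rewrite leq_exp2l// leq_addr.
Qed.

Section Jets.
(* [b k l m] is the coefficient of the monomial of exponents [l], [m] in the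
   data of the component [k] on the plane; for the component [0], whose data
   live on the first axis, only [b 0 l 0] is used.  The exponents of the
   parameter and of the three coordinates are denoted [j], [l], [m], [n]. *)
Variables (R : realType) (b : 'I_3 -> nat -> nat -> R).

(** The effect on coefficients of the multiplication by the parameter. *)
Definition lower (E : nat -> nat -> nat -> R) (j l m : nat) : R :=
  if j is j'.+1 then E j' l m else 0.

(** The derivatives of the data along the plane, which do not involve the
    parameter. *)
Definition plane_jet (k : 'I_3) (j l m : nat) : R :=
  if j is 0 then (l`! * m`!)%:R * b k l m else 0.

(** The derivatives of the component [0] along the plane, obtained from those
    along the first axis by means of the constraint. *)
Fixpoint line_jet (m j l : nat) : R :=
  if m is m'.+1 then plane_jet 1 j l.+1 m' - lower (plane_jet 2) j l m'
  else plane_jet 0 j l 0.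

(** [jet n k j l m] is the coefficient of the [j]-th power of the parameter in
    the derivative of order [(l, m, n)] of the component [k] at the base
    point. *)
Fixpoint jet (n : nat) (k : 'I_3) (j l m : nat) : R :=
  if n is n'.+1 then
    if k == 0 then jet n' 2 j l.+1 m + lower (jet n' 1) j l m
    else if k == 1 then jet n' 2 j l m.+1 - lower (jet n' 0) j l m
    else - jet n' 0 j l.+1 m - jet n' 1 j l m.+1
  else if k == 0 then line_jet m j l else plane_jet k j l m.

Lemma jetS0 n j l m :
  jet n.+1 0 j l m = jet n 2 j l.+1 m + lower (jet n 1) j l m.
Proof. by []. Qed.

Lemma jetS1 n j l m :
  jet n.+1 1 j l m = jet n 2 j l m.+1 - lower (jet n 0) j l m.
Proof. by []. Qed.

Lemma jetS2 n j l m :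
  jet n.+1 2 j l m = - jet n 0 j l.+1 m - jet n 1 j l m.+1.
Proof. by []. Qed.

(** The constraint on the initial plane propagates to all orders. *)
Lemma jet_constraint n j l m :
  jet n 1 j l.+1 m - jet n 0 j l m.+1 = lower (jet n 2) j l m.
Proof.
elim: n j l m => [|n IH] j l m.
  by transitivity (lower (plane_jet 2) j l m); [exact: subKr|case: j].
rewrite jetS1 jetS0.
have -> : lower (jet n.+1 2) j l m =
    - lower (jet n 0) j l.+1 m - lower (jet n 1) j l m.+1.
  by case: j => [|j]; [rewrite /= oppr0 addr0|exact: jetS2].
ring.
Qed.

(** The degree in the parameter is at most the order of derivation. *)
Lemma jet_support n k j l m : (l + m + n < j)%N -> jet n k j l m = 0.
Proof.
have lower0 E j' l' m' : (forall j, (j'.-1 <= j)%N -> E j l' m' = 0) ->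
    lower E j' l' m' = 0.
  by case: j' => //= j' H; rewrite H.
elim: n k j l m => [|n IH] k j l m h.
  have P k' l' m' j' : (0 < j')%N -> plane_jet k' j' l' m' = 0 by case: j'.
  rewrite /=; case: ifP => _; last by rewrite P//; lia.
  case: m h => [|m] h /=; first by rewrite P//; lia.
  rewrite P; last by lia.
  by rewrite lower0 ?subr0// => j' h'; rewrite P//; lia.
elim/ord3P: k; rewrite ?jetS0 ?jetS1 ?jetS2.
- by rewrite IH ?lower0 ?addr0//; [move=> j' h'; apply: IH|]; lia.
- by rewrite IH ?lower0 ?subr0//; [move=> j' h'; apply: IH|]; lia.
- by rewrite !IH ?subr0 ?oppr0//; lia.
Qed.

Variables (M rho : R).
Hypothesis M0 : 0 <= M.
Hypothesis rho1 : 1 <= rho.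
Let rho0 : 0 <= rho := le_trans ler01 rho1.
Hypothesis bM : forall k l m, `|b k l m| <= M * rho ^+ (l + m).

(** In the recursion, a jet is, up to signs, the sum of two jets whose order
    [l + m + n] is not larger and whose weight [n + n + m] is smaller; the
    factor [2 ^+ (n + n + m)] absorbs the two summands. *)
Definition jet_majorant (n l m : nat) : R :=
  M * rho ^+ (l + m + n) * 2 ^+ (n + n + m) * ((l + m + n)`!)%:R.

Lemma jet_majorantE n l m N e : (N = l + m + n)%N -> (e = n + n + m)%N ->
  jet_majorant n l m = M * rho ^+ N * 2 ^+ e * (N`!)%:R.
Proof. by move=> -> ->. Qed.

Lemma majorant_le N N' e e' : (N' <= N)%N -> (e' < e)%N ->
  M * rho ^+ N' * 2 ^+ e' * (N'`!)%:R <= (M * rho ^+ N * 2 ^+ e * (N`!)%:R) / 2.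
Proof.
move=> NN ee.
have -> : (M * rho ^+ N * 2 ^+ e * (N`!)%:R) / 2 =
    M * rho ^+ N * 2 ^+ e.-1 * (N`!)%:R.
  by rewrite -(ltn_predK ee) exprS/=; field.
apply: ler_pM.
- by rewrite !mulr_ge0// exprn_ge0.
- by [].
- apply: ler_pM.
  + by rewrite mulr_ge0// exprn_ge0.
  + by rewrite exprn_ge0.
  + by rewrite ler_wpM2l// ler_weXn2l.
  + by rewrite ler_weXn2l ?ler1n//; lia.
- by rewrite ler_nat leq_fact.
Qed.

Lemma norm_lower_le (E : nat -> nat -> nat -> R) j l m x : 0 <= x ->
  (forall j, `|E j l m| <= x) -> `|lower E j l m| <= x.
Proof. by case: j => [|j] x0 H; rewrite ?normr0//=. Qed.

Lemma majorant_ge0 n l m : 0 <= jet_majorant n l m.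
Proof. by rewrite !mulr_ge0// exprn_ge0. Qed.

Lemma plane_jet_bound k j l m : `|plane_jet k j l m| <= jet_majorant 0 l m.
Proof.
case: j => [|j]; last by rewrite normr0 majorant_ge0.
rewrite /= normrM ger0_norm// (@jet_majorantE _ _ _ (l + m) m)//.
  2: by rewrite addn0.
rewrite mulrC.
apply: ler_pM => //.
- apply: (le_trans (bM k l m)); rewrite ler_peMr ?mulr_ge0// ?exprn_ge0//.
  by rewrite exprn_ege1// ler1n.
- rewrite ler_nat -(@bin_fact (l + m) l) ?leq_addr// addKn leq_pmull// bin_gt0.
  by rewrite leq_addr.
Qed.

Lemma line_jet_bound m j l : `|line_jet m j l| <= jet_majorant 0 l m.
Proof.
case: m => [|m]; first exact: plane_jet_bound.
rewrite /= (le_trans (ler_normB _ _))//.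
rewrite (@jet_majorantE _ _ _ (l + m).+1 m.+1)//; last by rewrite addn0 addnS.
rewrite [leRHS]splitr lerD//.
  apply: (le_trans (plane_jet_bound _ _ _ _)).
  by apply: majorant_le; lia.
apply: norm_lower_le => [|j']; first by rewrite !mulr_ge0// exprn_ge0.
apply: (le_trans (plane_jet_bound _ _ _ _)).
by apply: majorant_le; lia.
Qed.

Lemma jet_bound n k j l m : `|jet n k j l m| <= jet_majorant n l m.
Proof.
elim: n k j l m => [|n IH] k j l m.
  by rewrite /=; case: ifP => _; [exact: line_jet_bound|exact: plane_jet_bound].
have half k' j' l' m' : (l' + m' <= (l + m).+1)%N -> (m' <= m.+1)%N ->
    `|jet n k' j' l' m'| <= jet_majorant n.+1 l m / 2.
  by move=> h1 h2; apply: (le_trans (IH _ _ _ _)); apply: majorant_le; lia.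
have halfl k' : `|lower (jet n k') j l m| <= jet_majorant n.+1 l m / 2.
  apply: norm_lower_le => [|j']; first by rewrite divr_ge0// majorant_ge0.
  by apply: half; lia.
rewrite [leRHS]splitr; elim/ord3P: k.
- rewrite jetS0 (le_trans (ler_normD _ _))// lerD//; apply: half; lia.
- rewrite jetS1 (le_trans (ler_normB _ _))// lerD//; apply: half; lia.
- rewrite jetS2 (le_trans (ler_normB _ _))// normrN lerD//; apply: half; lia.
Qed.

(** The weight is at most [2 * (l + m + n)] and the trinomial coefficient at
    most [4 ^ (l + m + n)], whence the constant 16. *)
Lemma jet_coef_bound n k j l m :
  `|jet n k j l m / (l`! * m`! * n`!)%:R| <= M * (16 * rho) ^+ (l + m + n).
Proof.
have w0 : 0 < (l`! * m`! * n`!)%:R :> R by rewrite ltr0n !muln_gt0 !fact_gt0.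
rewrite normrM normfV (gtr0_norm w0) ler_pdivrMr//.
apply: (le_trans (jet_bound _ _ _ _ _)).
rewrite /jet_majorant exprMn.
have -> : (16 : R) ^+ (l + m + n) = 4 ^+ (l + m + n) * 4 ^+ (l + m + n).
  by rewrite -exprMn; congr (_ ^+ _); ring.
have -> : M * (4 ^+ (l + m + n) * 4 ^+ (l + m + n) * rho ^+ (l + m + n)) *
    (l`! * m`! * n`!)%:R = M * rho ^+ (l + m + n) * 4 ^+ (l + m + n) *
    (4 ^+ (l + m + n) * (l`! * m`! * n`!)%:R) by ring.
apply: ler_pM => //.
- by rewrite !mulr_ge0// exprn_ge0.
- rewrite ler_wpM2l ?mulr_ge0 ?exprn_ge0//.
  have -> : 4 = 2 ^+ 2 :> R by ring.
  by rewrite -exprM ler_weXn2l ?ler1n//; lia.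
- by rewrite -natrX -natrM ler_nat trinomial_le.
Qed.

End Jets.

(** * The solution with given initial data *)

Lemma pderiv_row_mx (R : realType) (q m : nat) (theta : 'rV[R]_q)
    (f : 'rV[R]_(q + m) -> R) (x : 'rV[R]_m) (i : 'I_m) :
  pderiv i (fun y => f (row_mx theta y)) x =
  pderiv (rshift q i) f (row_mx theta x).
Proof.
rewrite /pderiv /derive.
suff -> : (fun h : R => h^-1 *: (((fun y => f (row_mx theta y)) \o shift x)
      (h *: delta_mx 0 i) - f (row_mx theta x))) =
    (fun h : R => h^-1 *: ((f \o shift (row_mx theta x))
      (h *: delta_mx 0 (rshift q i)) - f (row_mx theta x))) by [].
apply/funext => h /=; congr (_ *: (f _ - _)).
apply/rowP => j; have [j' ->|j' ->] := split_ordP j.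
  by rewrite row_mxEl [RHS]mxE row_mxEl !mxE eq_lrshift andbF mulr0 add0r.
by rewrite row_mxEr [RHS]mxE row_mxEr !mxE eq_rshift.
Qed.

(** Multiplication of a power series by the [i]-th variable. *)
Definition mulX_coef (R : realType) (m : nat) (i : 'I_m)
    (a : {ffun 'I_m -> nat} -> R) (al : {ffun 'I_m -> nat}) : R :=
  if al i is 0 then 0 else a [ffun j => (al j - (j == i))%N].

Lemma has_sum_mulX (R : realType) (m : nat) (i : 'I_m)
    (a : {ffun 'I_m -> nat} -> R) (y : 'I_m -> R) (s : R) :
  has_sum (pterm a y) s -> has_sum (pterm (mulX_coef i a) y) (y i * s).
Proof.
move=> H; apply/(has_sum_reindex (f := raise i)).
- exact: raise_inj.
- move=> al h; apply: raise_surj; rewrite lt0n; apply: contra h => /eqP h.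
  by rewrite /pterm /mulX_coef h mul0r.
- apply: has_sum_eq (has_sumZ (k := y i) H) => // al /=.
  rewrite /pterm /mulX_coef ffunE eqxx addn1 /=.
  have -> : [ffun j => raise i al j - (j == i)]%N = al.
    by apply/ffunP => j; rewrite !ffunE addnK.
  rewrite mulrCA; congr (_ * _).
  rewrite (bigD1 i)//= [in RHS](bigD1 i)//= mulrA ffunE eqxx addn1 exprS.
  congr (_ * _); apply: eq_bigr => j /negbTE ji.
  by rewrite ffunE ji addn0.
Qed.

Section Solution.
Variables (R : realType) (b : 'I_3 -> nat -> nat -> R).

(** The four variables: the parameter, and the three coordinates. *)
Definition par : 'I_(1 + 3) := lshift 3 0.
Definition spc (i : 'I_3) : 'I_(1 + 3) := rshift 1 i.

(** The factorial of the spatial part of a multi-index. *)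
Definition mfact (al : {ffun 'I_(1 + 3) -> nat}) : R :=
  ((al (spc 0))`! * (al (spc 1))`! * (al (spc 2))`!)%:R.

(** The Taylor coefficients of the component [k] of the solution, in the
    parameter and the coordinates. *)
Definition jet_coef (k : 'I_3) (al : {ffun 'I_(1 + 3) -> nat}) : R :=
  jet b (al (spc 2)) k (al par) (al (spc 0)) (al (spc 1)) /
  mfact al.

Lemma prod_par_spc (F : 'I_(1 + 3) -> R) :
  \prod_i F i = F par * (F (spc 0) * F (spc 1) * F (spc 2)).
Proof.
rewrite big_split_ord/= big_ord1 !big_ord_recr big_ord0 /= mul1r.
by congr (F _ * (F _ * F _ * F _)); exact/val_inj.
Qed.

Lemma raise_spc i k al :
  raise (spc i) al (spc k) = (al (spc k) + (k == i))%N.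
Proof. by rewrite ffunE eq_rshift. Qed.

Lemma raise_par i al : raise (spc i) al par = al par.
Proof. by rewrite ffunE eq_lrshift addn0. Qed.

Lemma fact_natr_neq0 n : n`!%:R != 0 :> R.
Proof. by rewrite pnatr_eq0 -lt0n fact_gt0. Qed.

Lemma dcoef_jet0 k al : dcoef (spc 0) (jet_coef k) al =
  jet b (al (spc 2)) k (al par) (al (spc 0)).+1 (al (spc 1)) /
  mfact al.
Proof.
rewrite /dcoef /jet_coef /mfact; move: (jet b) => J.
rewrite raise_par !raise_spc /= addn1 !addn0 factS !natrM.
have : (al (spc 0)).+1%:R != 0 :> R by rewrite pnatr_eq0.
by move: ((al (spc 0)).+1%:R) => N N0; field; rewrite !fact_natr_neq0 N0.
Qed.

Lemma dcoef_jet1 k al : dcoef (spc 1) (jet_coef k) al =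
  jet b (al (spc 2)) k (al par) (al (spc 0)) (al (spc 1)).+1 /
  mfact al.
Proof.
rewrite /dcoef /jet_coef /mfact; move: (jet b) => J.
rewrite raise_par !raise_spc /= addn1 !addn0 factS !natrM.
have : (al (spc 1)).+1%:R != 0 :> R by rewrite pnatr_eq0.
by move: ((al (spc 1)).+1%:R) => N N0; field; rewrite !fact_natr_neq0 N0.
Qed.

Lemma dcoef_jet2 k al : dcoef (spc 2) (jet_coef k) al =
  jet b (al (spc 2)).+1 k (al par) (al (spc 0)) (al (spc 1)) /
  mfact al.
Proof.
rewrite /dcoef /jet_coef /mfact; move: (jet b) => J.
rewrite raise_par !raise_spc /= addn1 !addn0 factS !natrM.
have : (al (spc 2)).+1%:R != 0 :> R by rewrite pnatr_eq0.
by move: ((al (spc 2)).+1%:R) => N N0; field; rewrite !fact_natr_neq0 N0.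
Qed.

Lemma mulX_jet k al : mulX_coef par (jet_coef k) al =
  lower (jet b (al (spc 2)) k) (al par) (al (spc 0)) (al (spc 1)) /
  mfact al.
Proof.
rewrite /mulX_coef; case E : (al par) => [|j]; first by rewrite mul0r.
by rewrite /jet_coef /mfact !ffunE E !eq_rlshift eqxx subn1 !subn0.
Qed.

(** The coefficients satisfy the equation curl u = c u. *)
Lemma jet_curl j al :
  dcoef (spc (j + 1)) (jet_coef (j + 2)) al
    - dcoef (spc (j + 2)) (jet_coef (j + 1)) al =
  mulX_coef par (jet_coef j) al.
Proof.
have e12 : 1 + 2 = 0 :> 'I_3 by exact/val_inj.
have e21 : 2 + 1 = 0 :> 'I_3 by exact/val_inj.
have e22 : 2 + 2 = 1 :> 'I_3 by exact/val_inj.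
have e11 : 1 + 1 = 2 :> 'I_3 by exact/val_inj.
rewrite mulX_jet; elim/ord3P: j.
- rewrite !add0r dcoef_jet1 dcoef_jet2 -mulrBl; congr (_ / _).
  by rewrite jetS1 subKr.
- rewrite e11 e12 dcoef_jet2 dcoef_jet0 -mulrBl; congr (_ / _).
  by rewrite jetS0 addrAC subrr add0r.
- rewrite e21 e22 dcoef_jet0 dcoef_jet1 -mulrBl; congr (_ / _).
  exact: jet_constraint.
Qed.

(** The coefficients satisfy the equation div u = 0. *)
Lemma jet_div al : \sum_(i < 3) dcoef (spc i) (jet_coef i) al = 0.
Proof.
rewrite sum_ord3 dcoef_jet0 dcoef_jet1 dcoef_jet2 jetS2 -!mulrDl.
by rewrite (_ : _ + _ = 0) ?mul0r//; ring.
Qed.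

Variables (M rho : R).
Hypothesis M0 : 0 <= M.
Hypothesis rho1 : 1 <= rho.
Hypothesis bM : forall k l m, `|b k l m| <= M * rho ^+ (l + m).

(** The parameter may range over any bounded interval, at the cost of a smaller
    radius [r] in the coordinates. *)
Lemma jet_coef_dominated (C : R) : 0 <= C ->
  exists2 r : R, 0 < r &
    forall k, dominated (jet_coef k) (fun i => if i == par then C else r).
Proof.
(* A monomial of spatial degree N has degree at most N in the parameter, so it
   contributes at most [(1 + C) ^+ N] through the parameter. *)
move=> C0; have Q0 : 0 < 16 * rho by rewrite mulr_gt0// (lt_le_trans ltr01).
have C1 : 0 < 1 + C by lra.
have QC : 0 < 16 * rho * (1 + C) by rewrite mulr_gt0.
exists (16 * rho * (1 + C))^-1; first by rewrite invr_gt0.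
move=> k; exists M => al; rewrite prod_par_spc eqxx !eq_rlshift /= -!exprD.
set l := al (spc 0); set m := al (spc 1); set n := al (spc 2).
have [h|h] := ltnP (l + m + n) (al par).
  by rewrite /jet_coef jet_support// mul0r normr0 mul0r.
apply: (@le_trans _ _ ((M * (16 * rho) ^+ (l + m + n)) *
    ((1 + C) ^+ (l + m + n) * (16 * rho * (1 + C))^-1 ^+ (l + m + n)))).
  apply: ler_pM => //.
  - by rewrite mulr_ge0// exprn_ge0// invr_ge0 ltW.
  - exact: jet_coef_bound.
  - apply: ler_wpM2r; first by rewrite exprn_ge0// invr_ge0 ltW.
    apply: (@le_trans _ _ ((1 + C) ^+ al par)).
      by rewrite lerXn2r// ?nnegrE ?lerDr// ltW.
    by rewrite ler_weXn2l// lerDl.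
rewrite -exprMn -mulrA -exprMn mulrA divff ?expr1n ?mulr1// gt_eqF//.
Qed.

End Solution.

(** The sum of a power series where it converges (an unspecified value
    elsewhere). *)
Definition psum (R : realType) (m : nat) (a : {ffun 'I_m -> nat} -> R)
    (y : 'I_m -> R) : R := lim (partial_sum (pterm a y) @ totally).

Lemma psumE (R : realType) (m : nat) (a : {ffun 'I_m -> nat} -> R)
    (y : 'I_m -> R) (s : R) : has_sum (pterm a y) s -> psum a y = s.
Proof. by move=> H; apply: cvg_lim. Qed.

Lemma has_psum (R : realType) (m : nat) (a : {ffun 'I_m -> nat} -> R)
    (y : 'I_m -> R) :
  abs_summable (pterm a y) -> has_sum (pterm a y) (psum a y).
Proof. by move=> /abs_summable_has_sum[s Hs]; rewrite (psumE Hs). Qed.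

Section Field.
Variables (R : realType) (b : 'I_3 -> nat -> nat -> R) (p : 'rV[R]_3).
Variables (M rho : R).
Hypothesis M0 : 0 <= M.
Hypothesis rho1 : 1 <= rho.
Hypothesis bM : forall k l m, `|b k l m| <= M * rho ^+ (l + m).

(** The base point, with parameter [0]. *)
Definition center : 'rV[R]_(1 + 3) := row_mx 0 p.

(** The component [k] of the solution, as a function of the parameter and the
    point. *)
Definition jet_sum (k : 'I_3) (z : 'rV[R]_(1 + 3)) : R :=
  psum (jet_coef b k) (fun i => z 0 i - center 0 i).

(** The solution with proportionality factor [theta]. *)
Definition jet_field (theta : 'rV[R]_1) (x : 'rV[R]_3) : 'rV[R]_3 :=
  \row_k jet_sum k (row_mx theta x).

Lemma center_par (theta : 'rV[R]_1) (x : 'rV[R]_3) :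
  (row_mx theta x) 0 par - center 0 par = theta 0 0.
Proof. by rewrite !row_mxEl mxE subr0. Qed.

Lemma center_spc (theta : 'rV[R]_1) (x : 'rV[R]_3) i :
  (row_mx theta x) 0 (spc i) - center 0 (spc i) = x 0 i - p 0 i.
Proof. by rewrite !row_mxEr. Qed.

Lemma par_or_spc (i : 'I_(1 + 3)) : i = par \/ exists k, i = spc k.
Proof.
have [j ->|j ->] := split_ordP i; last by right; exists j.
by left; rewrite (ord1 j).
Qed.

Lemma jet_sum_polydisc (theta : 'rV[R]_1) :
  exists C r : R, [/\ 0 < r,
    forall k, dominated (jet_coef b k) (fun i => if i == par then C else r),
    forall k (z : 'rV[R]_(1 + 3)),
      (forall i, `|z 0 i - center 0 i| < if i == par then C else r) ->
      has_sum (pterm (jet_coef b k) (fun i => z 0 i - center 0 i)) (jet_sum k z)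
   & forall x : 'rV[R]_3, (forall i, `|x 0 i - p 0 i| < r) ->
      forall i, `|(row_mx theta x) 0 i - center 0 i| <
        if i == par then C else r].
Proof.
have C0 : 0 <= `|theta 0 0| + 1 by rewrite addr_ge0.
have [r r0 Hr] := jet_coef_dominated M0 rho1 bM C0.
exists (`|theta 0 0| + 1), r; split => //.
  move=> k z Hz; apply: has_psum.
  exact: (dominated_abs_summable (Hr k) Hz).
move=> x Hx i; have [->|[k ->]] := par_or_spc i.
  by rewrite eqxx center_par ltrDl.
by rewrite eq_rlshift center_spc.
Qed.

Lemma jet_sum_analytic (theta : 'rV[R]_1) k :
  exists2 r : R, 0 < r &
    forall x : 'rV[R]_3, (forall i, `|x 0 i - p 0 i| < r) ->
    exists a, expands (jet_sum k) (row_mx theta x) a.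
Proof.
have [C [r [r0 dom Hs Hx]]] := jet_sum_polydisc theta.
exists r => // x /Hx xr.
by have [a [Ha _]] := polydisc_expands (dom k) (Hs k) xr; exists a.
Qed.

Lemma jet_field_beltrami (theta : 'rV[R]_1) (U : set 'rV[R]_3) :
  open U -> U p ->
  exists V : set 'rV[R]_3, [/\ open V, V p, V `<=` U &
    beltrami V (fun=> theta 0 0) (jet_field theta)].
Proof.
move=> oU Up; have [C [r [r0 dom Hs Hx]]] := jet_sum_polydisc theta.
pose W : set 'rV[R]_3 := [set x | U x /\ forall i, `|x 0 i - p 0 i| < r].
have Wp : nbhs p W.
  have /near_rowP[e e0 HU] : \forall x \near p, U x by exact: open_nbhs_nbhs.
  apply/near_rowP; exists (Num.min e r); first by rewrite lt_min e0.
  move=> x Hxe; split => [|i]; last by have := Hxe i; rewrite lt_min => /andP[].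
  by apply: HU => i; have := Hxe i; rewrite lt_min => /andP[].
exists W^°; split; [exact: open_interior|exact: Wp| |].
  by apply: (subset_trans (@interior_subset _ W)) => x [].
split.
- by move=> q _; eexists; exact: expands_const.
- move=> j q /interior_subset[_ /Hx qr].
  have [a [Ha _]] := polydisc_expands (dom j) (Hs j) qr.
  exists (a \o ext_index (@rshift 1 3)); rewrite -/(expands _ _ _).
  apply: expands_eq (@expands_restrict _ _ _ (@rshift 1 3) _ (jet_sum j)
    (row_mx theta) (row_mx theta q) q a _ _ Ha) => //.
  + by apply/near_rowP; exists 1 => // x _; rewrite mxE.
  + exact: rshift_inj.
  + by move=> y i; rewrite !row_mxEr.
  + move=> y i Hi; have [i' ->|i' ei] := split_ordP i.
      by rewrite !row_mxEl.
    by have := Hi i'; rewrite ei eqxx.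
move=> x /interior_subset[_ /Hx xr].
pose y i := (row_mx theta x) 0 i - center 0 i.
have D i k : has_sum (pterm (dcoef (spc i) (jet_coef b k)) y)
    (pderiv i (fun x => jet_field theta x 0 k) x).
  have -> : pderiv i (fun x => jet_field theta x 0 k) x =
      pderiv (spc i) (jet_sum k) (row_mx theta x).
    rewrite -pderiv_row_mx; congr (pderiv i _ x).
    by apply/funext => x'; rewrite mxE.
  exact: (polydisc_pderiv (dom k) (Hs k) xr).
split.
  apply/rowP => j; rewrite !mxE.
  apply: (has_sum_unique (has_sumB (D _ _) (D _ _))).
  rewrite -(center_par theta x).
  have := has_sum_mulX (i := par) (Hs j _ xr).
  apply: has_sum_eq => // al; rewrite /pterm -mulrBl; congr (_ * _).
  by rewrite -jet_curl.
have := has_sum_sum (r := index_enum 'I_3) (fun i => D i i).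
move=> /has_sum_unique; apply.
apply: has_sum_eq (@has_sum0 R _) => // al.
by rewrite /pterm -big_distrl /= jet_div mul0r.
Qed.

End Field.

(** * Determination of a solution by its data *)

Section Determination.
Variable R : realType.

(** The equations curl u = c u and div u = 0, read on the Taylor
    coefficients [v] of [u]. *)
Definition beltrami_coef (c : R) (v : 'I_3 -> {ffun 'I_3 -> nat} -> R) : Prop :=
  (forall j al, dcoef (j + 1) (v (j + 2)) al - dcoef (j + 2) (v (j + 1)) al =
     c * v j al) /\
  forall al, \sum_(i < 3) dcoef i (v i) al = 0.

(** A Beltrami field with constant factor has Taylor coefficients at each point
    of its domain, and they satisfy the equations. *)
Lemma beltrami_expands (V : set 'rV[R]_3) (c : R) u p :
  open V -> V p -> beltrami V (fun=> c) u ->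
  exists2 v, forall k, expands (fun x => u x 0 k) p (v k) & beltrami_coef c v.
Proof.
move=> oV Vp [_ au eu].
have /choice[v Hv] : forall k, exists a, expands (fun x => u x 0 k) p a.
  by move=> k; exact: au.
have nV : \forall x \near p, V x by exact: open_nbhs_nbhs.
exists v => //; split=> [j al|al].
  apply: (expands_unique (f := fun x => curl u x 0 j) (p := p)
    (a := fun al => _ al - _ al) (b := fun al => c * v j al)).
    apply: expands_eq (expandsB (expands_pderiv (j + 1) (Hv (j + 2)))
      (expands_pderiv (j + 2) (Hv (j + 1)))) => //.
    by apply/near_rowP; exists 1 => // x _; rewrite mxE.
  apply: expands_eq (expandsZ c (Hv j)) => //.
  by apply: filterS nV => x /eu[-> _]; rewrite mxE.
apply: (expands0_coef (a := fun al => \sum_(i < 3) dcoef i (v i) al)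
  (p := p) _ erefl).
apply: expands_eq (expandsD (expandsD (expands_pderiv 0 (Hv 0))
  (expands_pderiv 1 (Hv 1))) (expands_pderiv 2 (Hv 2))) => //; last first.
  by move=> al'; rewrite sum_ord3.
by apply: filterS nV => x /eu[_ <-]; rewrite /div sum_ord3.
Qed.

(** The dimension of the coordinate subspace carrying the data of the component
    [i]: the first axis for [0], the plane of the first two coordinates for the
    other components. *)
Definition data_dim (i : 'I_3) : 'I_4 :=
  if val i == 0%N then @Ordinal 4 1 isT else @Ordinal 4 2 isT.

(** The inclusion of the coordinates of the data subspace. *)
Definition data_axis (i : 'I_3) : 'I_(data_dim i) -> 'I_3 :=
  widen_ord (leq_ord (data_dim i)).

Lemma data_axis_inj i : injective (@data_axis i).
Proof. by move=> x y /(congr1 val) /= /val_inj. Qed.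

(** By induction on the exponent of the last coordinate and, for the component
    [0] at exponent zero, on that of the second coordinate. *)
Lemma beltrami_coef_unique c v w : beltrami_coef c v -> beltrami_coef c w ->
  (forall i be, v i (ext_index (@data_axis i) be) =
                w i (ext_index (@data_axis i) be)) ->
  forall k al, v k al = w k al.
Proof.
move=> [vc vd] [wc wd] base.
have dcoef_inj i k be :
    dcoef i (v k) be = dcoef i (w k) be -> v k (raise i be) = w k (raise i be).
  by rewrite /dcoef; apply: mulfI; rewrite pnatr_eq0.
have on_data (k : 'I_3) (al : {ffun 'I_3 -> nat}) :
    (forall i : 'I_3, (data_dim k <= i)%N -> al i = 0%N) -> v k al = w k al.
  move=> H; have [|be <-] := @ext_index_surj _ _ _ (@data_axis_inj k) al.
    move=> i Hi; apply: H; rewrite leqNgt; apply/negP => ik.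
    have := Hi (Ordinal ik).
    by rewrite (_ : data_axis _ = i) ?eqxx//; exact/val_inj.
  exact: base.
have e12 : (1 + 2 = 0 :> 'I_3) by exact/val_inj.
have e21 : (2 + 1 = 0 :> 'I_3) by exact/val_inj.
have e22 : (2 + 2 = 1 :> 'I_3) by exact/val_inj.
have e11 : (1 + 1 = 2 :> 'I_3) by exact/val_inj.
have plane k (al : {ffun 'I_3 -> nat}) : al 2 = 0%N -> v k al = w k al.
  have v12 (k' : 'I_3) (be : {ffun 'I_3 -> nat}) : k' != 0 -> be 2 = 0%N ->
      v k' be = w k' be.
    move=> k0 b2; apply: on_data => i.
    have -> : (data_dim k' : nat) = 2%N.
      by rewrite /data_dim ifN//; apply: contra k0 => /eqP k0;
        apply/eqP/val_inj.
    by elim/ord3P: i.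
  elim/ord3P: k; [|exact: v12|exact: v12].
  elim: {al}(al 1) {-2}al (erefl (al 1)) => [|n IH] al al1 al2.
    apply: on_data => i; elim/ord3P: i => // _; exact: al1.
  have [be bei] := @raise_surj _ 1 al ltac:(by rewrite al1).
  have be1 : be 1 = n by move: al1; rewrite -bei ffunE eqxx addn1 => -[].
  have be2 : be 2 = 0%N by move: al2; rewrite -bei ffunE addn0.
  rewrite -bei; apply: dcoef_inj.
  have A : dcoef 0 (v 1) be = dcoef 0 (w 1) be.
    by rewrite /dcoef v12// ffunE be2.
  have := vc 2 be; rewrite e21 e22 (v12 2)// -(wc 2 be) e21 e22 A.
  by move=> /addrI/oppr_inj.
suff H n (al : {ffun 'I_3 -> nat}) : al 2 = n -> forall k, v k al = w k al.
  by move=> k al; exact: H.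
elim: n al => [|n IH] al al2 k; first exact: plane.
have [be bei] := @raise_surj _ 2 al ltac:(by rewrite al2).
have be2 : be 2 = n by move: al2; rewrite -bei ffunE eqxx addn1 => -[].
have A i k' : i != 2 -> dcoef i (v k') be = dcoef i (w k') be.
  by rewrite eq_sym => /negbTE i2; rewrite /dcoef IH// ffunE be2 i2 addn0.
rewrite -bei; apply: dcoef_inj; elim/ord3P: k.
- have := vc 1 be; rewrite e11 e12 (IH be be2 1) -(wc 1 be) e11 e12 (A 0)//.
  by move=> /addIr.
- have := vc 0 be; rewrite !add0r (IH be be2 0) -(wc 0 be) !add0r (A 1)//.
  by move=> /addrI/oppr_inj.
- have := etrans (vd be) (esym (wd be)); rewrite !sum_ord3 (A 0)// (A 1)//.
  by move=> /addrI.
Qed.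

End Determination.

(** * Solutions and their data *)

Section Data.
Variable R : realType.

(** The values of the components on their data subspaces; no derivative is
    prescribed. *)
Definition cauchy_data (i : 'I_3) : datum 3 3 := Datum (data_dim i) [::] i.

(** The parametrization of the data subspace of the component [i] through [p],
    in the form it takes in [has_data] for the standard frame. *)
Definition embed (p : 'rV[R]_3) (i : 'I_3) (y : 'rV[R]_(data_dim i)) :
    'rV[R]_3 :=
  p + y *m pid_mx (data_dim i) *m 1%:M.

Lemma embed_axis p i (y : 'rV[R]_(data_dim i)) j :
  embed p y 0 (data_axis j) - p 0 (data_axis j) = y 0 j.
Proof.
rewrite /embed mulmx1 [X in X - _]mxE addrAC subrr add0r mxE (bigD1 j)//= big1.
  by rewrite addr0 mxE /= eqxx ltn_ord mulr1.
by move=> j' /negbTE jj'; rewrite mxE /= (inj_eq val_inj) jj' mulr0.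
Qed.

Lemma embed_off p i (y : 'rV[R]_(data_dim i)) k :
  (forall j : 'I_(data_dim i), data_axis j != k) -> embed p y 0 k = p 0 k.
Proof.
move=> H; rewrite /embed mulmx1 !mxE big1 ?addr0// => j _.
rewrite mxE (_ : (_ == _) = false) ?mulr0//.
by apply/negbTE; apply: contra (H j) => /eqP e; apply/eqP/val_inj.
Qed.

Lemma expands_embed (f : 'rV[R]_3 -> R) p i a : expands f p a ->
  expands (fun y => f (embed p y)) 0 (a \o ext_index (@data_axis i)).
Proof.
apply: (@expands_restrict _ _ _ _ (@data_axis_inj i) f (@embed p i)).
  by move=> y j; rewrite embed_axis mxE subr0.
exact: embed_off.
Qed.

(* [gc i] is the family of Taylor coefficients of the data of the component
   [i]. *)
Variable gc : forall i : 'I_3, {ffun 'I_(data_dim i) -> nat} -> R.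

(** The data coefficients indexed by a pair of exponents; the second exponent is
    ignored when the data subspace is a line. *)
Definition data_coef (i : 'I_3) (l m : nat) : R :=
  gc [ffun j : 'I_(data_dim i) => if val j == 0%N then l else m].

(** The coordinates of the data subspace, among the parameter and the three
    coordinates. *)
Definition data_var (i : 'I_3) (j : 'I_(data_dim i)) : 'I_(1 + 3) :=
  spc (data_axis j).

Lemma data_var_inj i : injective (@data_var i).
Proof. by move=> x y /rshift_inj/data_axis_inj. Qed.

(** The formal solution restricts to the data. *)
Lemma jet_coef_data i be :
  jet_coef data_coef i (ext_index (@data_var i) be) = gc be.
Proof.
have off (k : 'I_3) : (data_dim i <= k)%N ->
    ext_index (@data_var i) be (spc k) = 0%N.
  move=> ik; apply: ext_index_out => j; rewrite eq_rshift.
  by apply/eqP => /(congr1 val)/= jk; move: ik; rewrite -jk leqNgt ltn_ord.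
have t0 : ext_index (@data_var i) be par = 0%N.
  by apply: ext_index_out => j; rewrite eq_rlshift.
rewrite /jet_coef /mfact t0 (off 2); last by elim/ord3P: i {be off t0}.
set l := ext_index _ be (spc 0); set m := ext_index _ be (spc 1).
have -> : gc be = data_coef i l m.
  rewrite /data_coef; congr gc; apply/ffunP => j; rewrite ffunE.
  rewrite -(ext_indexE (@data_var_inj i) be j).
  case: eqP => j0; first by congr (ext_index _ _ (spc _)); exact/val_inj.
  congr (ext_index _ _ (spc _)); apply/val_inj/eqP.
  have d2 : (data_dim i <= 2)%N by elim/ord3P: (i).
  by rewrite eqn_leq -ltnS (leq_trans (ltn_ord j) d2) lt0n; exact/eqP.
have w0 : (l`! * m`!)%:R != 0 :> R.
  by rewrite pnatr_eq0 -lt0n muln_gt0 !fact_gt0.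
rewrite /= muln1; case: eqP => [i0|_]; last by rewrite mulrC mulKf.
have m0 : m = 0%N by apply: off; rewrite i0.
by rewrite m0 /= mulrC -i0 mulKf// -m0.
Qed.

(** On its data subspace, the component [i] of the formal solution does not
    depend on the parameter. *)
Lemma jet_coef_off_data i al :
  (forall be, ext_index (@data_var i) be <> al) ->
  (forall k : 'I_3, (data_dim i <= k)%N -> al (spc k) = 0%N) ->
  jet_coef data_coef i al = 0.
Proof.
move=> Hal off.
have t0 : al par != 0%N.
  apply/negP => /eqP t0.
  have [|be] := @ext_index_surj _ _ _ (@data_var_inj i) al; last exact: Hal.
  move=> k Hk; have [->//|[k' ek]] := par_or_spc k.
  rewrite ek off// leqNgt; apply/negP => ik.
  have := Hk (Ordinal ik); rewrite ek (_ : data_var _ = spc k') ?eqxx//.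
  by congr spc; exact/val_inj.
rewrite /jet_coef off; last by elim/ord3P: (i).
case: (al par) t0 => // j _ /=.
have [i0|_] := eqVneq i 0; last by rewrite mul0r.
by rewrite off ?mul0r// i0.
Qed.

Lemma jet_field_data (g : forall i : 'I_3, 'rV[R]_(data_dim i) -> R) p theta :
  (forall i, expands (g i) 0 (@gc i)) ->
  forall i, \forall y \near (0 : 'rV[R]_(data_dim i)),
    jet_field data_coef p theta (embed p y) 0 i = g i y.
Proof.
move=> Hg i; have /near_rowP[e e0 H] := Hg i.
apply/near_rowP; exists e => // y Hy.
rewrite mxE; apply: psumE.
set z := fun i => _ - _.
have zs k : z (spc k) = embed p y 0 k - p 0 k by exact: center_spc.
apply: (proj2 (@has_sum_ext_index _ _ _ _ (@data_var_inj i) _ z _ _)).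
  move=> al Hal.
  have [[k [ik ak]]|N] := pselect
    (exists k : 'I_3, (data_dim i <= k)%N /\ al (spc k) != 0%N).
    rewrite /pterm (bigD1 (spc k))//= zs embed_off.
      by rewrite subrr expr0n (negbTE ak) mul0r mulr0.
    move=> j; apply/eqP => /(congr1 val)/= jk.
    by move: ik; rewrite -jk leqNgt ltn_ord.
  rewrite /pterm jet_coef_off_data ?mul0r// => k ik.
  by apply/eqP/negPn/negP => ak; apply: N; exists k.
apply: has_sum_eq (H y Hy) => // be.
rewrite /pterm /= jet_coef_data; congr (_ * _); apply: eq_bigr => j _.
by rewrite zs embed_axis mxE subr0.
Qed.

Lemma data_coef_bound (g : forall i : 'I_3, 'rV[R]_(data_dim i) -> R) :
  (forall i, expands (g i) 0 (@gc i)) ->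
  exists M rho : R, [/\ 0 <= M, 1 <= rho &
    forall k l m, `|data_coef k l m| <= M * rho ^+ (l + m)].
Proof.
move=> Hg.
have bound k : exists Mr : R * R, [/\ 0 <= Mr.1, 1 <= Mr.2 &
    forall l m, `|data_coef k l m| <= Mr.1 * Mr.2 ^+ (l + m)].
  have [e e0 [[M HM] _]] := expands_dominated (Hg k).
  have M0 : 0 <= M.
    apply: le_trans (HM [ffun=> 0%N]); rewrite mulr_ge0// prodr_ge0// => i _.
    by rewrite exprn_ge0// ltW.
  exists (M, 1 + e^-1); split=> //= [|l m].
    by rewrite lerDl invr_ge0 ltW.
  rewrite /data_coef; set be := [ffun j => _].
  have be_le : (\sum_j be j <= l + m)%N.
    rewrite /be; elim/ord3P: k {Hg HM be} => /=.
    - by rewrite big_ord1 ffunE /= leq_addr.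
    - by rewrite big_ord_recl big_ord1 !ffunE.
    - by rewrite big_ord_recl big_ord1 !ffunE.
  have := HM be; rewrite prodrXr => He.
  have eb : 0 < e ^+ (\sum_j be j) by rewrite exprn_gt0.
  apply: (@le_trans _ _ (M * (1 + e^-1) ^+ (\sum_j be j))).
    apply: (@le_trans _ _ (M * e^-1 ^+ (\sum_j be j))).
      by rewrite exprVn ler_pdivlMr.
    rewrite ler_wpM2l// lerXn2r// ?nnegrE ?addr_ge0 ?invr_ge0 ?(ltW e0)//.
    by rewrite lerDr.
  by rewrite ler_wpM2l// ler_weXn2l// lerDl invr_ge0 ltW.
have /choice[Mr HMr] := bound.
exists (\sum_k (Mr k).1), (\sum_k (Mr k).2).
have r0 k : 0 <= (Mr k).2 by have [_ h _] := HMr k; exact: le_trans h.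
have le1 k : (Mr k).1 <= \sum_k (Mr k).1.
  rewrite (bigD1 k)//= lerDl sumr_ge0// => k' _.
  by have [] := HMr k'.
have le2 k : (Mr k).2 <= \sum_k (Mr k).2.
  by rewrite (bigD1 k)//= lerDl sumr_ge0.
split.
- by apply: sumr_ge0 => k _; have [] := HMr k.
- have [_ h _] := HMr 0; exact: le_trans h (le2 0).
- move=> k l m; have [h1 h2 h] := HMr k; apply: (le_trans (h l m)).
  apply: ler_pM => //; first by rewrite exprn_ge0.
  by rewrite lerXn2r// ?nnegrE// (le_trans (r0 k)).
Qed.

End Data.

Theorem theorem1p2 (R : realType) (U : set 'rV[R]_3) (hU : open U) :
  locally_parametrized 2 2 U (@beltrami_constant_factor R).
Proof.
(* Every point is generic.  The frame is the standard one, there is one datum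
   for each component, and the parameter is the proportionality factor. *)
exists U; split => //; first exact: subset_closure.
move=> p Up; exists 1%:M, 3%N, cauchy_data, 1%N; split.
- exact: unitmx1.
- by elim/ord3P.
- rewrite (_ : [set i | _]%SET = [set~ 0]%SET) ?cardsC1 ?card_ord//.
  by apply/setP => i; rewrite !inE; elim/ord3P: i.
- move=> u [V [oV Vp _ [c Bu]]].
  have [v Hv _] := beltrami_expands oV Vp Bu.
  exists (fun i y => u (embed p y) 0 i) => i.
    by eexists; exact: (expands_embed i (Hv i)).
  by apply/near_rowP; exists 1.
move=> g Hg; pose gc i := projT1 (cid (Hg i)).
have gE i : expands (g i) 0 (gc i) := projT2 (cid (Hg i)).
have [M [rho [M0 rho1 bM]]] := data_coef_bound gE.
have sol theta := jet_field_beltrami M0 rho1 bM theta hU Up.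
exists (jet_field (data_coef gc) p); split.
- move=> theta; split; last by move=> i; exact: jet_field_data gE i.
  have [V [oV Vp VU B]] := sol theta.
  by exists V; split=> //; exists (theta 0 0).
- move=> theta j; have [r r0 Hr] := jet_sum_analytic p M0 rho1 bM theta j.
  have [|a Ha] := Hr p; first by move=> i; rewrite subrr normr0.
  exists a; apply: expands_eq Ha => //.
  by apply/near_rowP; exists 1 => // z _; rewrite mxE hsubmxK.
move=> u [V [oV Vp _ [c Bu]]] du; exists (const_mx c).
have [W [oW Wp _ Bphi]] := sol (const_mx c); rewrite mxE in Bphi.
have [v Hv cv] := beltrami_expands oV Vp Bu.
have [w Hw cw] := beltrami_expands oW Wp Bphi.
have vw := beltrami_coef_unique cv cw _.
have eqk k : \forall x \near p,
    u x 0 k = jet_field (data_coef gc) p (const_mx c) x 0 k.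
  have vwk : v k =1 w k.
    apply: vw => i; apply: (expands_unique (f := g i) (p := 0)).
      by apply: expands_eq (expands_embed i (Hv i)) => //; exact: du.
    apply: expands_eq (expands_embed i (Hw i)) => //.
    exact: jet_field_data gE i.
  apply: filterS2 (Hv k) (Hw k) => x Hx.
  by move: Hx; rewrite (funext vwk); exact: has_sum_unique.
apply: filterS3 (eqk 0) (eqk 1) (eqk 2) => x e0 e1 e2.
by apply/rowP; exact: ord3P.
Qed.
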